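(* Let $R$ be a finitely generated commutative unital $\mathbb{R}$-algebra and let $n$ be a positive integer. For every left ideal $J$ of the algebra $M_n(R)$ of all $n\times n$ matrices over $R$, $$\sqrt[\mathcal{E}]{J}=\sqrt[\mathrm{real}]{J},$$ i.e. the real saturation of $J$ equals the real radical of $J$.
   Context: Let $R$ be a finitely generated commutative unital $\mathbb{R}$-algebra and $\mathcal{A}=M_n(R)$ the algebra of all $n\times n$ matrices over $R$, with the transpose $H\mapsto H^T$ as involution. Write $V_{\mathbb{R}}(R)$ for the set of all (unital) $\mathbb{R}$-algebra homomorphisms $R\to\mathbb{R}$ (this set may be empty), and let $V_{\mathbb{R}}(\mathcal{A})$ be the set of all pairs $(\phi,\mathbf{u})$ with $\phi\in V_{\mathbb{R}}(R)$ and $\mathbf{u}\in\mathbb{R}^n$. For $\phi\in V_{\mathbb{R}}(R)$ and $G\in\mathcal{A}$, $\phi_n(G)\in M_n(\mathbb{R})$ denotes the matrix obtained by applying $\phi$ to each entry of $G$. For a left ideal $J$ of $\mathcal{A}$: (1) The real zero set of $J$ is $Z_{\mathbb{R}}(J)=\{(\phi,\mathbf{u})\in V_{\mathbb{R}}(\mathcal{A}) \mid \phi_n(G)\mathbf{u}=0 \text{ for all } G\in J\}$. (2) The real saturation of $J$ is $\sqrt[\mathcal{E}]{J}=\{F\in\mathcal{A} \mid \phi_n(F)\mathbf{u}=0 \text{ for all } (\phi,\mathbf{u})\in Z_{\mathbb{R}}(J)\}$. (3) $J$ is called real if for every finite family $H_1,\ldots,H_k\in\mathcal{A}$ such that $H_1^TH_1+\cdots+H_k^TH_k\in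 J+J^T$ we have $H_1,\ldots,H_k\in J$, where $J^T=\{G^T \mid G\in J\}$. (4) The real radical $\sqrt[\mathrm{real}]{J}$ is the smallest real left ideal of $\mathcal{A}$ containing $J$ (it always exists). *)

(* Defs.v *)
From mathcomp Require Import all_boot all_order all_algebra.
From mathcomp Require Import all_classical all_reals.

Set Implicit Arguments.
Unset Strict Implicit.
Unset Printing Implicit Defensive.

Import GRing.Theory.
Local Open Scope classical_set_scope.
Local Open Scope ring_scope.

(* A commutative unital algebra over the reals K is a commutative ring A
   together with its structure morphism iota : K -> A.  The types comAlgType and
   comNzRingType would exclude the zero algebra, hence comPzRingType. *)

Definition subalgebra (K : realType) (A : comPzRingType)
    (iota : {rmorphism K -> A}) (S : set A) : Prop :=
  [/\ forall c, S (iota c),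
      forall a b, S a -> S b -> S (a + b)
    & forall a b, S a -> S b -> S (a * b)].

Definition finitely_generated (K : realType) (A : comPzRingType)
    (iota : {rmorphism K -> A}) : Prop :=
  exists s : seq A, smallest (subalgebra iota) [set` s] = setT.

Definition alg_homs (K : realType) (A : comPzRingType)
    (iota : {rmorphism K -> A}) : set {rmorphism A -> K} :=
  [set phi | forall c, phi (iota c) = c].

Definition real_points (K : realType) (A : comPzRingType)
    (iota : {rmorphism K -> A}) (n : nat) :
    set ({rmorphism A -> K} * 'cV[K]_n) :=
  alg_homs iota `*` setT.

Definition left_ideal (A : comPzRingType) (n : nat) (J : set 'M[A]_n) : Prop :=
  [/\ J 0,
      forall F G, J F -> J G -> J (F + G)
    & forall F G, J G -> J (F *m G)].

Definition real_zeros (K : realType) (A : comPzRingType)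
    (iota : {rmorphism K -> A}) (n : nat) (J : set 'M[A]_n) :
    set ({rmorphism A -> K} * 'cV[K]_n) :=
  [set p | real_points iota p /\ forall G, J G -> map_mx p.1 G *m p.2 = 0].

Definition real_saturation (K : realType) (A : comPzRingType)
    (iota : {rmorphism K -> A}) (n : nat) (J : set 'M[A]_n) : set 'M[A]_n :=
  [set F | forall p, real_zeros iota J p -> map_mx p.1 F *m p.2 = 0].

Definition real_ideal (A : comPzRingType) (n : nat) (J : set 'M[A]_n) : Prop :=
  forall (k : nat) (H : 'I_k -> 'M[A]_n),
    [set F + G^T | F in J & G in J] (\sum_(i < k) (H i)^T *m H i) ->
    forall i, J (H i).

Definition real_left_ideal (A : comPzRingType) (n : nat) (J : set 'M[A]_n) :
    Prop :=
  left_ideal J /\ real_ideal J.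

Definition real_radical (A : comPzRingType) (n : nat) (J : set 'M[A]_n) :
    set 'M[A]_n :=
  smallest (@real_left_ideal A n) J.

(* smallest is an intersection; real_radical_real and real_radical_min show
   that it is indeed the least real left ideal containing J. *)
Lemma real_radical_real (A : comPzRingType) (n : nat) (J : set 'M[A]_n) :
  real_left_ideal (real_radical J) /\ J `<=` real_radical J.
Proof.
split; last by move=> F JF I [_]; apply.
split; first split.
- by move=> I [[[]]].
- move=> F G JF JG I cI.
  by case: (cI) => [[[_ + _] _] _]; apply; [exact: JF | exact: JG].
- by move=> F G JG I cI; case: (cI) => [[[_ _ +] _] _]; apply; exact: JG.
move=> k H [F JF [G JG FG]] i I cI.
case: (cI) => [[_ +] _]; apply; exists F; first exact: JF.
by exists G; first exact: JG.
Qed.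

Lemma real_radical_min (A : comPzRingType) (n : nat) (J I : set 'M[A]_n) :
  real_left_ideal I -> J `<=` I -> real_radical J `<=` I.
Proof. by move=> rI JI F; apply. Qed.

(* Main.v *)
Require Import Defs.
From HB Require Import structures.
From mathcomp Require Import all_boot all_order all_algebra.
From mathcomp Require Import closed_field generic_quotient ring_quotient fraction.
From mathcomp Require Import polyorder polyrcf qe_rcf_th.
From mathcomp Require Import all_classical all_reals.
From mathcomp Require Import ring lra.

(** Replacing a real left ideal by its preimage over a polynomial ring
    Q = K[x_1, ..., x_m] that maps onto the algebra, let F lie outside the real
    left ideal I, let N be the module of the rows of elements of I, and let f be
    a row of F outside N.  Since Q is noetherian, f has a multiple, again denoted
    f, such that p = (N : f) is prime.  The reality of I makes p real and keeps
    every multiple c f with c outside p out of N + p Q^n, so row reduction of N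
    modulo p yields a delta outside p such that f is not in the span of N at any
    zero of p where delta does not vanish.

    It remains to find a real zero of p off the zero set of delta.  Only finitely
    many coefficients are involved, so p can be restricted to a polynomial ring W
    over the countable ring generated by them.  The fraction field of the domain
    of W modulo p has an algebraic closure C, in which a maximal cone containing
    the sums of squares modulo p spans a real closed field L.  Sturm sequences
    then transport the signs of finitely many polynomials from a point over L to
    a point over K, one coordinate at a time. *)

Set Implicit Arguments.
Unset Strict Implicit.
Unset Printing Implicit Defensive.

Import Order.TTheory GRing.Theory Num.Theory.
Local Open Scope classical_set_scope.
Local Open Scope ring_scope.

(** * Cones and real closed subfields of an algebraically closed field *)

Definition diff_set (F : fieldType) (T : set F) : set F :=
  [set z | exists x y, [/\ T x, T y & z = x - y]].

(* A cone orders the subfield [diff_set T] partially; the whole field, being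
   algebraically closed in the application, has no ordering. *)
Record cone (F : fieldType) (T : set F) : Prop := Cone {
  cone1 : T 1;
  coneD : forall x y, T x -> T y -> T (x + y);
  coneM : forall x y, T x -> T y -> T (x * y);
  coneV : forall x, T x -> T x^-1;
  cone_sqrB : forall x y, T x -> T y -> T ((x - y) ^+ 2);
  coneN1 : ~ T (-1)
}.

Section Cone.
Variables (F : fieldType) (T : set F) (cT : cone T).

Lemma cone0 : T 0.
Proof. by have := cone_sqrB cT (cone1 cT) (cone1 cT); rewrite subrr expr0n. Qed.

Lemma cone_diff x : T x -> diff_set T x.
Proof. by move=> Tx; exists x, 0; rewrite subr0; split=> //; exact: cone0. Qed.

Lemma cone_sqr z : diff_set T z -> T (z ^+ 2).
Proof. by move=> [x [y [Tx Ty ->]]]; exact: cone_sqrB. Qed.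

Lemma diffD x y : diff_set T x -> diff_set T y -> diff_set T (x + y).
Proof.
move=> [a [b [Ta Tb ->]]] [c [d [Tc Td ->]]]; exists (a + c), (b + d).
by split; [exact: coneD|exact: coneD|rewrite opprD addrACA].
Qed.

Lemma diffN x : diff_set T x -> diff_set T (- x).
Proof. by move=> [a [b [Ta Tb ->]]]; exists b, a; rewrite opprB. Qed.

Lemma diffM x y : diff_set T x -> diff_set T y -> diff_set T (x * y).
Proof.
move=> [a [b [Ta Tb ->]]] [c [d [Tc Td ->]]].
exists (a * c + b * d), (a * d + b * c); split.
- by apply: coneD => //; exact: coneM.
- by apply: coneD => //; exact: coneM.
- by ring.
Qed.

Lemma diffV x : diff_set T x -> diff_set T x^-1.
Proof.
move=> Dx; have [->|x0] := eqVneq x 0; first by rewrite invr0; exact: cone_diff cone0.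
have -> : x^-1 = x * (x ^+ 2)^-1 by rewrite expr2 invfM mulrA divff // mul1r.
by apply: diffM => //; apply: cone_diff; apply: coneV => //; exact: cone_sqr.
Qed.

Lemma cone_anti x : T x -> T (- x) -> x = 0.
Proof.
move=> Tx TNx; apply/eqP/negPn/negP => x0; apply: (coneN1 cT).
have -> : -1 = - x * x^-1 by rewrite mulNr divff.
by apply: coneM => //; exact: coneV.
Qed.

End Cone.

Definition maximal_cone (F : fieldType) (T : set F) :=
  cone T /\ forall T', cone T' -> T `<=` T' -> T' `<=` T.

Lemma cone_maximal (F : fieldType) (T0 : set F) : cone T0 ->
  exists2 T, maximal_cone T & T0 `<=` T.
Proof.
move=> cT0.
(* [Zorn_bigcup] asks for the union of the empty chain, hence the disjunct [set0]. *)
pose P := [set T : set F | T = set0 \/ (cone T /\ T0 `<=` T)].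
have [|T [PT maxT]] := @Zorn_bigcup F P.
  move=> G GP Gtot.
  have [[X0 [GX0 X00]]|noX] := pselect (exists X, G X /\ X <> set0); last first.
    left; apply/seteqP; split=> // x [X GX Xx].
    case: noX; exists X; split=> // E; by rewrite E in Xx.
  have inP X x : G X -> X x -> cone X /\ T0 `<=` X.
    by move=> GX Xx; case: (GP X GX) => // E; rewrite E in Xx.
  have [cX0 TX0] : cone X0 /\ T0 `<=` X0 by case: (GP _ GX0).
  have two x y : (\bigcup_(X in G) X) x -> (\bigcup_(X in G) X) y ->
     exists X, [/\ G X, cone X, X x & X y].
    move=> [X GX Xx] [Y GY Yy].
    have [XY|YX] := Gtot _ _ GX GY.
      by exists Y; split=> //; [case: (inP _ _ GY Yy)|exact: XY].
    by exists X; split=> //; [case: (inP _ _ GX Xx)|exact: YX].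
  right; split; last by move=> x T0x; exists X0 => //; exact: TX0.
  split.
  - by exists X0 => //; exact: cone1.
  - by move=> x y Ux Uy; have [X [GX cX Xx Xy]] := two _ _ Ux Uy;
      exists X => //; exact: coneD.
  - by move=> x y Ux Uy; have [X [GX cX Xx Xy]] := two _ _ Ux Uy;
      exists X => //; exact: coneM.
  - by move=> x Ux; have [X [GX cX Xx _]] := two _ _ Ux Ux;
      exists X => //; exact: coneV.
  - by move=> x y Ux Uy; have [X [GX cX Xx Xy]] := two _ _ Ux Uy;
      exists X => //; exact: cone_sqrB.
  - by move=> U1; have [X [GX cX X1 _]] := two _ _ U1 U1; exact: (coneN1 cX).
have [T00|[cT TT0]] := PT.
  exfalso; apply: (maxT T0); last (by right; split).
  by split; [move=> x|move=> /(_ 1 (cone1 cT0))]; rewrite T00.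
exists T => //; split=> // T' cT' TT' x T'x; apply: contrapT => nTx.
apply: (maxT T'); first by split=> // /(_ _ T'x).
by right; split=> //; exact: subset_trans TT'.
Qed.

Section MaximalCone.
Variables (F : fieldType) (T : set F) (mT : maximal_cone T).
Let cT : cone T := mT.1.

(** When [z] is outside [T], the set [T'] of all [a - z * b] is again a cone. It contains [T] and
    [- z], so maximality puts [- z] into [T]. *)
Lemma maximal_cone_total z : diff_set T z -> T z \/ T (- z).
Proof.
move=> Dz; have [|nTz] := pselect (T z); first by left.
right; pose T' := [set x | exists a b, [/\ T a, T b & x = a - z * b]].
have T'D x : T' x -> diff_set T x.
  move=> [a [b [Ta Tb ->]]]; apply: diffD => //; first exact: cone_diff.
  by apply: diffN; apply: diffM => //; exact: cone_diff.
have TT' : T `<=` T'.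
  by move=> x Tx; exists x, 0; rewrite mulr0 subr0; split=> //; exact: cone0.
have T'MT x y : T' x -> T y -> T' (x * y).
  move=> [a [b [Ta Tb ->]]] Ty; exists (a * y), (b * y).
  by split; [exact: coneM|exact: coneM|rewrite mulrBl mulrA].
suff cT' : cone T'.
  apply: (mT.2 _ cT' TT'); exists 0, 1; rewrite mulr1 sub0r.
  by split=> //; [exact: cone0|exact: cone1].
split.
- by apply: TT'; exact: cone1.
- move=> _ _ [a [b [Ta Tb ->]]] [c [d [Tc Td ->]]]; exists (a + c), (b + d).
  by split; [exact: coneD|exact: coneD|rewrite mulrDr opprD addrACA].
- move=> _ _ [a [b [Ta Tb ->]]] [c [d [Tc Td ->]]].
  exists (a * c + z ^+ 2 * (b * d)), (a * d + b * c); split.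
  + apply: coneD => //; first exact: coneM.
    by apply: coneM => //; [exact: cone_sqr|exact: coneM].
  + by apply: coneD => //; exact: coneM.
  + by ring.
- move=> x T'x; have [->|x0] := eqVneq x 0.
    by rewrite invr0; apply: TT'; exact: cone0.
  have -> : x^-1 = x * (x ^+ 2)^-1 by rewrite expr2 invfM mulrA divff // mul1r.
  by apply: T'MT => //; apply: coneV => //; apply: cone_sqr => //; exact: T'D.
- move=> x y /T'D Dx /T'D Dy; apply: TT'; apply: cone_sqr => //.
  by apply: diffD => //; exact: diffN.
(* If -1 were [a - z * b] with [b] nonzero, then [z = (1 + a) / b] would lie in [T]. *)
- move=> [a [b [Ta Tb E]]]; have [b0|b0] := eqVneq b 0.
    by apply: (coneN1 cT); rewrite E b0 mulr0 subr0.
  apply: nTz; have -> : z = (1 + a) * b^-1.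
    by apply: (canRL (mulfK b0)); rewrite -[1]opprK E; ring.
  by apply: coneM => //; [apply: coneD => //; exact: cone1|exact: coneV].
Qed.

End MaximalCone.

(** The argument [mT] lets the instances below, which rest on [T] being a maximal cone, be inferred
    from the predicate itself. *)
Definition in_cone_field (F : fieldType) (T : set F) (mT : maximal_cone T) :
  {pred F} := fun x => `[< diff_set T x >].

Lemma in_cone_field_divring (F : fieldType) (T : set F) (mT : maximal_cone T) :
  divring_closed (in_cone_field mT).
Proof.
have cT := mT.1; split.
- by apply/asboolP; apply: cone_diff => //; exact: cone1.
- move=> x y /asboolP Dx /asboolP Dy; apply/asboolP.
  by apply: diffD => //; exact: diffN.
- move=> x y /asboolP Dx /asboolP Dy; apply/asboolP.
  by apply: diffM => //; exact: diffV.
Qed.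

HB.instance Definition _ (F : fieldType) (T : set F) (mT : maximal_cone T) :=
  GRing.isDivringClosed.Build F (in_cone_field mT) (in_cone_field_divring mT).

Section ConeField.
Variables (F : fieldType) (T : set F) (mT : maximal_cone T).

Record cone_field := ConeField {
  cone_val :> F; cone_valP : cone_val \in in_cone_field mT }.

HB.instance Definition _ := [isSub for cone_val].
HB.instance Definition _ := [Choice of cone_field by <:].
HB.instance Definition _ := [SubChoice_isSubIntegralDomain of cone_field by <:].
HB.instance Definition _ := [SubIntegralDomain_isSubField of cone_field by <:].

Implicit Types x y z : cone_field.

Definition cone_le x y : bool := `[< T (y - x : cone_field) >].
Definition cone_lt x y : bool := (y != x) && cone_le x y.
Definition cone_norm x : cone_field := if cone_le 0 x then x else - x.

Lemma cone_ge0E x : cone_le 0 x = `[< T x >].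
Proof. by rewrite /cone_le subr0. Qed.

Lemma cone_field_total x : T x \/ T (- x : cone_field).
Proof. by apply: maximal_cone_total => //; exact/asboolP/(valP x). Qed.

Lemma cone_le0_anti x : cone_le 0 x -> cone_le x 0 -> x = 0.
Proof.
rewrite /cone_le subr0 sub0r => /asboolP Tx /asboolP TNx.
by apply/val_inj/(cone_anti mT.1).
Qed.

Lemma cone_le0D x y : cone_le 0 x -> cone_le 0 y -> cone_le 0 (x + y).
Proof.
rewrite !cone_ge0E => /asboolP Tx /asboolP Ty; apply/asboolP.
exact: (coneD mT.1).
Qed.

Lemma cone_le0M x y : cone_le 0 x -> cone_le 0 y -> cone_le 0 (x * y).
Proof.
rewrite !cone_ge0E => /asboolP Tx /asboolP Ty; apply/asboolP.
exact: (coneM mT.1).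
Qed.

Lemma cone_sub_ge0 x y : cone_le 0 (y - x) = cone_le x y.
Proof. by rewrite /cone_le subr0. Qed.

Lemma cone_le0_total x : cone_le 0 x || cone_le x 0.
Proof.
rewrite /cone_le subr0 sub0r; apply/orP.
by case: (cone_field_total x) => h; [left|right]; apply/asboolP.
Qed.

Lemma cone_normN x : cone_norm (- x) = cone_norm x.
Proof.
have H y : cone_le 0 (- y) = cone_le y 0 by rewrite -(cone_sub_ge0 y 0) sub0r.
rewrite /cone_norm H opprK; case: ifPn => [x0|Nx0]; case: ifPn => // x1.
  by rewrite (cone_le0_anti x1 x0) oppr0.
by have := cone_le0_total x; rewrite (negbTE x1) (negbTE Nx0).
Qed.

Lemma cone_ge0_norm x : cone_le 0 x -> cone_norm x = x.
Proof. by rewrite /cone_norm => ->. Qed.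

Lemma cone_lt_def x y : cone_lt x y = (y != x) && cone_le x y.
Proof. by []. Qed.

HB.instance Definition _ := Num.IntegralDomain_isLeReal.Build cone_field
  cone_le0D cone_le0M cone_le0_anti cone_sub_ge0 cone_le0_total cone_normN
  cone_ge0_norm cone_lt_def.

Lemma cone_field_ge0 x : (0 <= x) = `[< T x >].
Proof. exact: cone_ge0E. Qed.

Definition cone_field_incl (x : cone_field) : F := cone_val x.
Lemma cone_val_zmod : zmod_morphism cone_field_incl. Proof. by []. Qed.
Lemma cone_val_monoid : monoid_morphism cone_field_incl. Proof. by []. Qed.
HB.instance Definition _ := GRing.isZmodMorphism.Build cone_field F
  cone_field_incl cone_val_zmod.
HB.instance Definition _ := GRing.isMonoidMorphism.Build cone_field F
  cone_field_incl cone_val_monoid.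

End ConeField.

(** * Weighted sums of squares of polynomials *)

Section WeightedSquares.
Variable R : realFieldType.
Implicit Types (f g p : {poly R}) (s : seq (R * {poly R})).

(** The weights are kept apart from the squares because a nonnegative element of [R] need not be a
    square. *)
Definition wsum s : {poly R} := \sum_(tg <- s) tg.1 *: tg.2 ^+ 2.
Definition nneg_weights s := all (fun tg => 0 <= tg.1) s.

Lemma wsum_horner_ge0 s x : nneg_weights s -> 0 <= (wsum s).[x].
Proof.
move=> /allP s0; rewrite /wsum horner_sum big_seq.
by apply: sumr_ge0 => tg /s0 ?; rewrite hornerZ horner_exp mulr_ge0 // sqr_ge0.
Qed.

Lemma wsumD s1 s2 : wsum (s1 ++ s2) = wsum s1 + wsum s2.
Proof. by rewrite /wsum big_cat. Qed.

Lemma wsumM s1 s2 :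
  wsum [seq (u.1 * v.1, u.2 * v.2) | u <- s1, v <- s2] = wsum s1 * wsum s2.
Proof.
rewrite /wsum big_allpairs_dep big_distrlr /=; apply: eq_bigr => u _.
by apply: eq_bigr => v _; rewrite exprMn -scalerAl -scalerAr scalerA.
Qed.

Lemma nneg_weightsM s1 s2 : nneg_weights s1 -> nneg_weights s2 ->
  nneg_weights [seq (u.1 * v.1, u.2 * v.2) | u <- s1, v <- s2].
Proof.
move=> /allP s10 /allP s20; apply/allP => _ /allpairsP[[u v] [/= us vs ->]] /=.
by apply: mulr_ge0; [exact: s10|exact: s20].
Qed.

Lemma wsum_size s n : (forall tg, tg \in s -> (size tg.2 <= n)%N) ->
  (size (wsum s) <= n.*2.-1)%N.
Proof.
move=> sn; rewrite /wsum big_seq.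
apply: (big_ind (fun p : {poly R} => (size p <= n.*2.-1)%N)).
- by rewrite size_poly0.
- by move=> p q hp hq; rewrite (leq_trans (size_polyD _ _)) // geq_max hp.
- move=> tg /sn htg; rewrite (leq_trans (size_scale_leq _ _)) //.
  rewrite expr2 (leq_trans (size_polyMleq _ _)) //.
  by rewrite -addnn -!subn1 leq_sub2r // leq_add.
Qed.

End WeightedSquares.

(** * The intermediate value property in the field of a maximal cone *)

Section IVT.
Variables (C : closedFieldType) (T : set C) (mT : maximal_cone T).
Local Notation L := (cone_field mT).
Local Notation incl := (@cone_field_incl _ _ mT).
Let cT := mT.1.

Section Adjoin.
Variable a : C.
Local Notation ev g := ((map_poly incl g).[a]).

(* The elements [(sum t g(a)^2) / h(a)^2]: the cone generated by [T] and the
   squares of the field obtained by adjoining [a]. *)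
Definition adjoin_cone : set C :=
  [set x | exists (s : seq (L * {poly L})) h,
     [/\ nneg_weights s, ev h != 0 & x = ev (wsum s) / ev h ^+ 2]].

(** Common denominators give the closure properties; the inverse of [s / h^2] is rewritten as
    [s h^2 / s^2]. Only the absence of -1 has to be assumed. *)
Lemma adjoin_cone_is_cone : ~ adjoin_cone (-1) -> cone adjoin_cone.
Proof.
have wsq (g : {poly L}) : wsum [:: (1, g)] = g ^+ 2.
  by rewrite /wsum big_seq1 scale1r.
have ev1 : ev 1 = 1 by rewrite rmorph1 hornerC.
have nn1 (g : {poly L}) : nneg_weights [:: (1, g)] by rewrite /= ler01.
move=> N1; split=> //.
- exists [:: (1, 1)], 1; split=> //; first by rewrite ev1 oner_neq0.
  by rewrite wsq !expr1n ev1 expr1n divr1.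
- move=> _ _ [s [h [s0 h0 ->]]] [s' [h' [s'0 h'0 ->]]].
  exists ([seq (u.1 * v.1, u.2 * v.2) | u <- s, v <- [:: (1, h')]] ++
          [seq (u.1 * v.1, u.2 * v.2) | u <- s', v <- [:: (1, h)]]), (h * h').
  split.
  + by rewrite /nneg_weights all_cat; apply/andP; split; exact: nneg_weightsM.
  + by rewrite rmorphM hornerM mulf_neq0.
  + rewrite wsumD !wsumM !wsq rmorphD !rmorphM hornerD !hornerM.
    by field; apply/andP.
- move=> _ _ [s [h [s0 h0 ->]]] [s' [h' [s'0 h'0 ->]]].
  exists [seq (u.1 * v.1, u.2 * v.2) | u <- s, v <- s'], (h * h'); split.
  + exact: nneg_weightsM.
  + by rewrite rmorphM hornerM mulf_neq0.
  + by rewrite wsumM !rmorphM !hornerM; field; apply/andP.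
- move=> _ [s [h [s0 h0 ->]]]; have [E|E] := eqVneq (ev (wsum s)) 0.
    exists [::], 1; rewrite ev1 oner_neq0 E mul0r invr0 /wsum big_nil.
    by rewrite rmorph0 horner0 mul0r.
  exists [seq (u.1 * v.1, u.2 * v.2) | u <- s, v <- [:: (1, h)]], (wsum s).
  split=> //; first exact: nneg_weightsM.
  by rewrite wsumM wsq !rmorphM !hornerM; field; apply/andP.
- move=> _ _ [s [h [s0 h0 ->]]] [s' [h' [s'0 h'0 ->]]].
  exists [:: (1, wsum s * h' ^+ 2 - wsum s' * h ^+ 2)], ((h * h') ^+ 2).
  split=> //.
  + by rewrite !rmorphM !hornerM !mulf_neq0.
  + rewrite wsq !(rmorphM, rmorphB) !(hornerM, hornerD, hornerN).
    by field; apply/andP.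
Qed.

(** By maximality [adjoin_cone] is contained in [T]. Hence [T] contains the squares of [a + 1] and
    [a - 1], and [a] is a quarter of their difference. *)
Lemma adjoin_cone_val : ~ adjoin_cone (-1) -> exists x : L, incl x = a.
Proof.
move=> N1; have cA := adjoin_cone_is_cone N1.
have TA : T `<=` adjoin_cone.
  move=> x Tx.
  have Dx : x \in in_cone_field mT by apply/asboolP; exact: cone_diff.
  pose y : L := ConeField Dx; exists [:: (y, 1)], 1; split.
  - by rewrite /= cone_field_ge0 andbT; apply/asboolP.
  - by rewrite rmorph1 hornerC oner_neq0.
  - rewrite /wsum big_seq1 /= expr1n rmorph1 hornerC expr1n divr1.
    by rewrite alg_polyC map_polyC hornerC.
have Asq (g : {poly L}) : T (ev g ^+ 2).
  apply: (mT.2 _ cA TA); exists [:: (1, g)], 1; split.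
  - by rewrite /= ler01.
  - by rewrite rmorph1 hornerC oner_neq0.
  - rewrite /wsum big_seq1 /= scale1r rmorph1 hornerC expr1n divr1.
    by rewrite rmorphXn horner_exp.
have Tp : T ((a + 1) ^+ 2).
  by have := Asq ('X + 1); rewrite rmorphD /= map_polyX rmorph1 !hornerE.
have Tm : T ((a - 1) ^+ 2).
  by have := Asq ('X - 1); rewrite rmorphB /= map_polyX rmorph1 !hornerE.
have n4 : (4%:R : C) != 0.
  have -> : (4%:R : C) = incl 4%:R by rewrite rmorph_nat.
  by rewrite fmorph_eq0 pnatr_eq0.
have Dx : a \in in_cone_field mT.
  apply/asboolP.
  have -> : a = ((a + 1) ^+ 2 - (a - 1) ^+ 2) * incl 4%:R^-1.
    by rewrite fmorphV rmorph_nat; field.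
  apply: diffM => //; last by apply/asboolP/(cone_valP 4%:R^-1).
  by exists ((a + 1) ^+ 2), ((a - 1) ^+ 2).
by exists (ConeField Dx).
Qed.

End Adjoin.

(* If -1 is a weighted sum of squares modulo [f], then [f] divides some
   [1 + sum t g^2] with cofactor [q] of smaller degree; [q] also changes sign and
   hence has a root, at which [1 + sum t g^2 = 0], a contradiction. *)
Lemma cone_field_ivt_lt n (f : {poly L}) (a b : L) : (size f <= n)%N -> a <= b ->
  f.[a] * f.[b] < 0 -> exists2 x, a <= x <= b & root f x.
Proof.
elim: n f a b => [|n IHn] f a b sf leab fab.
  move: sf; rewrite leqn0 size_poly_eq0 => /eqP f0.
  by move: fab; rewrite f0 horner0 mul0r ltxx.
have fn0 : f != 0 by apply: contraTneq fab => ->; rewrite horner0 mul0r ltxx.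
(* A sign change of a product is a sign change of one of its factors, so a proper factorization of
   [f] is settled by induction. *)
have [[g [g1 gf gdf]]|nofac] := pselect
    (exists g : {poly L}, [/\ (1 < size g)%N, (size g < size f)%N & g %| f]).
  have [q Ef] : exists q, f = q * g by exists (f %/ g); rewrite divpK.
  have q0 : q != 0 by apply: contraNneq fn0 => q0; rewrite Ef q0 mul0r.
  have g0 : g != 0 by rewrite -size_poly_gt0 ltnW.
  have sq : (size q < size f)%N.
    rewrite Ef size_mul //; move: g1; case: (size g) => [|[|k]] // _.
    by rewrite !addnS /= ltnS leq_addr.
  have [qab|qab] := ltP (q.[a] * q.[b]) 0.
    have [|x xab qx] := IHn q a b _ leab qab; first by rewrite -ltnS (leq_trans sq).
    by exists x => //; rewrite Ef rootM qx.
  have gab : g.[a] * g.[b] < 0.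
    rewrite ltNge; apply/negP => gab; move: fab; rewrite Ef !hornerM mulrACA.
    by rewrite ltNge mulr_ge0.
  have [|x xab gx] := IHn g a b _ leab gab; first by rewrite -ltnS (leq_trans gf).
  by exists x => //; rewrite Ef rootM gx orbT.
have sf1 : (1 < size f)%N.
  rewrite ltnNge; apply/negP => /size1_polyC Ef; move: fab; rewrite Ef !hornerC.
  by rewrite ltNge -expr2 sqr_ge0.
have irrf : irreducible_poly f.
  split=> // g sg gf; have [sgf|sgf] := leqP (size f) (size g).
    by rewrite -dvdp_size_eqp // eqn_leq sgf dvdp_leq.
  case: nofac; exists g; split=> //.
  rewrite ltn_neqAle eq_sym sg size_poly_gt0 //=.
  by apply: contraTneq gf => ->; rewrite dvd0p.
have [al] : exists al : C, root (map_poly incl f) al.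
  by apply/closed_rootP; rewrite size_map_poly gtn_eqF.
move=> ral.
have cop (g : {poly L}) : (map_poly incl g).[al] = 0 -> f %| g.
  move=> g0; have [//|] := boolP (f %| g) => nfg.
  have : coprimep f g by rewrite irreducible_poly_coprime // irrf.
  rewrite -(coprimep_map incl) => /coprimep_root => /(_ _ ral).
  by rewrite g0 eqxx.
(* If -1 is not in the adjoined cone, the root [al] already lies in [L]. The irreducible [f] is then
   linear, and its sign change places the root between [a] and [b]. *)
have [N1|N1] := pselect (adjoin_cone al (-1)); last first.
  have [x Ex] := adjoin_cone_val N1.
  have rx : root f x by move: ral; rewrite -Ex fmorph_root.
  exists x => //.
  have : 'X - x%:P %= f.
    by apply: irrf.2; rewrite ?size_XsubC // dvdp_XsubCl.
  move=> /eqpf_eq [c c0 Ef].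
  have {}Ef : f = c^-1 *: ('X - x%:P) by rewrite Ef scalerA mulVf // scale1r.
  move: fab; rewrite Ef !hornerZ !hornerXsubC mulrACA -expr2.
  rewrite pmulr_rlt0; last by rewrite exprn_even_gt0 //= invr_eq0.
  move=> h; apply/andP; split; rewrite leNgt; apply/negP => hx; nra.
move: N1 => [s [h [s0 h0 E]]].
(* [u] inverts [h] modulo [f]: multiplying by its square clears the denominator, after which the
   squared polynomials are reduced modulo [f]. *)
have /Bezout_eq1_coprimepP[[u v] /= Euv] : coprimep h f.
  rewrite coprimep_sym; rewrite irreducible_poly_coprime //.
  apply: contra h0 => /dvdpP[q ->].
  by rewrite rmorphM hornerM (eqP ral) mulr0.
pose s' : seq (L * {poly L}) := [seq (tg.1, (u * tg.2) %% f) | tg <- s].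
have s'0 : nneg_weights s'.
  by apply/allP => _ /mapP[tg ts ->] /=; exact: (allP s0).
have evmod (g : {poly L}) : (map_poly incl (g %% f)).[al] = (map_poly incl g).[al].
  rewrite [in RHS](divp_eq g f) rmorphD rmorphM hornerD hornerM (eqP ral).
  by rewrite mulr0 add0r.
have evs' : (map_poly incl (wsum s')).[al] = -1.
  have -> : (map_poly incl (wsum s')).[al] =
       (map_poly incl u).[al] ^+ 2 * (map_poly incl (wsum s)).[al].
    rewrite /wsum big_map !rmorph_sum !horner_sum mulr_sumr.
    apply: eq_bigr => tg _ /=.
    by rewrite -!mul_polyC !rmorphM !hornerM evmod rmorphM hornerM; ring.
  have uh : (map_poly incl u).[al] * (map_poly incl h).[al] = 1.
    have /(congr1 (fun p => (map_poly incl p).[al])) := Euv.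
    by rewrite rmorphD !rmorphM rmorph1 !hornerE (eqP ral) mulr0 addr0.
  have hs : (map_poly incl (wsum s)).[al] = - (map_poly incl h).[al] ^+ 2.
    by rewrite -mulN1r E mulfVK // expf_neq0.
  by rewrite hs mulrN -exprMn uh expr1n.
have /dvdpP[q Eq] : f %| 1 + wsum s'.
  by apply: cop; rewrite rmorphD rmorph1 hornerD hornerC evs' subrr.
have pos x : 0 < (1 + wsum s').[x].
  by rewrite hornerD hornerC ltr_wpDr ?ltr01 // wsum_horner_ge0.
have q0 : q != 0.
  by apply: contraTneq (pos 0) => q0; rewrite Eq q0 mul0r horner0 ltxx.
(* With d the degree of [f], the reduced polynomials have degree below d, so the sum has degree at
   most 2d - 2 and [q] has degree at most d - 2. *)
have sq : (size q <= n)%N.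
  have : (size (1 + wsum s')%R <= ((size f).-1).*2.-1)%N.
    rewrite (leq_trans (size_polyD _ _)) // geq_max size_poly1.
    apply/andP; split; first by move: sf1; case: (size f) => [|[|[|k]]].
    apply: wsum_size => _ /mapP[tg _ ->] /=.
    by rewrite -ltnS prednK ?ltn_modp // (ltn_trans _ sf1).
  rewrite Eq size_mul // -addnn; move: sf sf1; case: (size f) => [|[|k]] //= sf _.
  by rewrite !addnS /= ltnS leq_add2r => /leq_trans; apply; exact: ltnW.
have qab : q.[a] * q.[b] < 0.
  have := mulr_gt0 (pos a) (pos b); rewrite Eq !hornerM mulrACA.
  by rewrite nmulr_lgt0.
have [x _ /eqP qx] := IHn q a b sq leab qab.
by have := pos x; rewrite Eq hornerM qx mul0r ltxx.
Qed.

Lemma cone_field_ivt : Num.real_closed_axiom L.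
Proof.
move=> p a b leab /andP[pa pb].
have [E|pa0] := eqVneq p.[a] 0; first by exists a; rewrite ?lexx ?leab //; apply/eqP.
have [E|pb0] := eqVneq p.[b] 0; first by exists b; rewrite ?lexx ?leab //; apply/eqP.
apply: (@cone_field_ivt_lt (size p)) => //.
by rewrite nmulr_rlt0 lt_neqAle ?pa0 ?pa // eq_sym pb0.
Qed.

HB.instance Definition _ := Num.RealField_isClosed.Build L cone_field_ivt.

End IVT.

Theorem cone_real_closed (C : closedFieldType) (T : set C) : cone T ->
  exists (L : rcfType) (j : {rmorphism L -> C}),
    forall x, T x -> exists2 y, 0 <= y & j y = x.
Proof.
move=> cT; have [T' mT TT'] := cone_maximal cT.
exists (cone_field mT : rcfType), (@cone_field_incl _ _ mT) => x Tx.
have Dx : x \in in_cone_field mT.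
  by apply/asboolP; apply: cone_diff; [exact: mT.1|exact: TT'].
exists (ConeField Dx) => //.
by rewrite cone_field_ge0; apply/asboolP/TT'.
Qed.

(** * Prime ideals and algebraically closed fields over their residue domains *)

Definition prime_ideal (R : comPzRingType) (p : set R) : Prop :=
  [/\ p 0, ~ p 1, forall a b, p a -> p b -> p (a + b),
      forall a b, p b -> p (a * b) & forall a b, p (a * b) -> p a \/ p b].

Lemma injective_pcancel (T U : Type) (f : T -> U) : injective f ->
  exists g, pcancel f g.
Proof.
move=> fI.
exists (fun n => if pselect (exists x, f x = n) is left e then Some (projT1 (cid e))
                 else None).
move=> x /=; case: pselect => [e|[]]; last by exists x.
by congr Some; apply: fI; case: cid.
Qed.

(** The injection makes [F] a countable field, to which [countable_algebraic_closure] applies. *)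
Lemma injective_countable_closure (F : fieldType) (f : F -> nat) : injective f ->
  exists C : closedFieldType, inhabited {rmorphism F -> C}.
Proof.
move=> /injective_pcancel[g fK].
pose Fc : countFieldType := HB.pack F (isCountable.Build F fK).
have [C [j _]] := countable_algebraic_closure Fc.
by exists C; exact: inhabits j.
Qed.

(** [j] is the composite of the projection onto the domain [W / q], its inclusion into the fraction
    field, and an algebraic closure of that field. Only the projection has a kernel. *)
Lemma prime_quotient_closed_field (W : comNzRingType) (f : W -> nat) (q : set W) :
  injective f -> prime_ideal q ->
  exists (C : closedFieldType) (j : {rmorphism W -> C}), forall w, j w = 0 <-> q w.
Proof.
move=> fI [q0 q1 qD qM qP].
pose I : {pred W} := fun w => `[< q w >].
have IE w : (w \in I) = `[< q w >] by [].
have I_closed : idealr_closed I.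
  split; [exact/asboolP | exact/asboolP|].
  by move=> a u v /asboolP qu /asboolP qv; apply/asboolP/qD => //; exact: qM.
have I_prime : prime_idealr_closed I.
  move=> u v /asboolP /qP [h|h]; apply/orP; [left|right]; exact/asboolP.
pose Ip : prime_idealr W := HB.pack I
   (GRing.isZmodClosed.Build _ I (idealr_closedB I_closed))
   (isProperIdeal.Build _ I (idealr_closed_nontrivial I_closed))
   (isPrimeIdealrClosed.Build _ I I_prime).
pose D : comNzRingType := {ideal_quot Ip}.
(* The integral domain structure is built on a unit ring: units and inverses are chosen classically,
   and a non-unit is its own formal inverse. *)
pose u : {pred D} := fun x => `[< exists y : D, y * x = 1 >].
pose v (x : D) : D :=
  if pselect (exists y : D, y * x = 1) is left e then projT1 (cid e) else x.
have vM : {in u, left_inverse 1 v *%R}.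
  by move=> x /asboolP ux; rewrite /v; case: pselect => // e; case: cid.
have uP x y : y * x = 1 -> u x by move=> h; apply/asboolP; exists y.
have v_out : {in [predC u], v =1 id}.
  by move=> x /asboolP ux; rewrite /v; case: pselect.
pose D1 : comUnitRingType :=
  HB.pack D (GRing.ComNzRing_hasMulInverse.Build D vM uP v_out).
have D1_dom : GRing.integral_domain_axiom D1.
  by move=> x y; exact: (@Quotient.rquot_IdomainAxiom W Ip x y).
pose D2 : idomainType := HB.pack D1 (GRing.ComUnitRing_isIntegral.Build D1 D1_dom).
pose pi : {rmorphism W -> D} := \pi_D%qT.
(* A fraction is coded by the values of [f] at representatives in [W] of its numerator and
   denominator. *)
pose k (z : {fraction D2}) : nat :=
  pickle (f (repr (frac (repr z)).1), f (repr (frac (repr z)).2)).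
have kI : injective k.
  move=> x y /(pcan_inj pickleK) [/fI h1 /fI h2].
  rewrite -[x]reprK -[y]reprK; congr (\pi_(_)%qT _); apply/val_inj => /=.
  have e1 := can_inj (@reprK _ (Quotient.quot Ip)) h1.
  have e2 := can_inj (@reprK _ (Quotient.quot Ip)) h2.
  rewrite [LHS]surjective_pairing [RHS]surjective_pairing.
  by rewrite e1 e2.
have [C [j]] := injective_countable_closure kI.
pose tof : {rmorphism D2 -> {fraction D2}} := @FracField.tofrac D2.
exists C, (j \o (tof \o (pi : {rmorphism W -> D2}))) => w /=.
split=> [/eqP|qw].
  rewrite fmorph_eq0 tofrac_eq0 => /eqP piw.
  have : (w == 0 %[mod {ideal_quot Ip}])%qT by apply/eqP; rewrite -[RHS]/(pi 0) rmorph0.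
  by rewrite -Quotient.idealrBE subr0 => /asboolP.
suff -> : pi w = 0 by rewrite !rmorph0.
rewrite -(rmorph0 pi); apply/eqP; rewrite -Quotient.idealrBE subr0; exact/asboolP.
Qed.

(** * Transfer of sign conditions between real closed fields *)

Section Near.
Import Pdiv.Ring.
Variables (P : comNzRingType) (K L : rcfType) (Phi : {rmorphism P -> L}).
Implicit Types (phi : {rmorphism P -> K}) (p q r h : {poly P}).

(* [Q] holds of every [phi] that gives the same signs as [Phi] to finitely many
   elements: the filter of specializations close to [Phi]. *)
Definition sign_near (Q : {rmorphism P -> K} -> Prop) : Prop :=
  exists S : seq P, forall phi,
    (forall s, s \in S -> sgz (phi s) = sgz (Phi s)) -> Q phi.

Lemma sign_nearT (Q : {rmorphism P -> K} -> Prop) : (forall phi, Q phi) -> sign_near Q.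
Proof. by move=> h; exists [::]. Qed.

Lemma sign_near_and (Q1 Q2 : {rmorphism P -> K} -> Prop) :
  sign_near Q1 -> sign_near Q2 -> sign_near (fun phi => Q1 phi /\ Q2 phi).
Proof.
move=> [S1 h1] [S2 h2]; exists (S1 ++ S2) => phi h; split.
  by apply: h1 => s s1; apply: h; rewrite mem_cat s1.
by apply: h2 => s s2; apply: h; rewrite mem_cat s2 orbT.
Qed.

Lemma sign_nearW (Q1 Q2 : {rmorphism P -> K} -> Prop) :
  (forall phi, Q1 phi -> Q2 phi) -> sign_near Q1 -> sign_near Q2.
Proof. by move=> h [S hS]; exists S => phi /hS /h. Qed.

Lemma sign_near2 (Q1 Q2 Q : {rmorphism P -> K} -> Prop) :
  (forall phi, Q1 phi -> Q2 phi -> Q phi) ->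
  sign_near Q1 -> sign_near Q2 -> sign_near Q.
Proof.
by move=> h n1 n2; apply: sign_nearW (sign_near_and n1 n2) => phi [/h]; apply.
Qed.

Lemma sign_near_sgz (x : P) : sign_near (fun phi => sgz (phi x) = sgz (Phi x)).
Proof. by exists [:: x] => phi; apply; rewrite mem_head. Qed.

Lemma sign_near_all (I : eqType) (s : seq I) (Q : I -> {rmorphism P -> K} -> Prop) :
  (forall i, i \in s -> sign_near (Q i)) ->
  sign_near (fun phi => forall i, i \in s -> Q i phi).
Proof.
elim: s => [|i s IHs] h; first by apply: sign_nearT.
have hs : sign_near (fun phi => forall i, i \in s -> Q i phi).
  by apply: IHs => j js; apply: h; rewrite inE js orbT.
apply: sign_near2 (h i (mem_head _ _)) hs => phi Qi Qs j.
by rewrite inE => /orP[/eqP->|/Qs].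
Qed.

Lemma sign_near_size p :
  sign_near (fun phi => size (map_poly phi p) = size (map_poly Phi p)).
Proof.
(* [p] stands here for its list of coefficients: knowing which of them vanish determines the size of
   the image. *)
exists p => phi h.
have coef0 i : (phi p`_i == 0) = (Phi p`_i == 0).
  have [ip|ip] := ltnP i (size p); last by rewrite nth_default // !rmorph0 !eqxx.
  by rewrite -[LHS]sgz_eq0 -[RHS]sgz_eq0 h // mem_nth.
have le k : (size (map_poly phi p) <= k)%N = (size (map_poly Phi p) <= k)%N.
  apply/leq_sizeP/leq_sizeP => z j /z; rewrite !coef_map => /eqP hj; apply/eqP.
    by rewrite -coef0.
  by rewrite coef0.
by apply/eqP; rewrite eqn_leq le leqnn -le leqnn.
Qed.

(** The leading coefficient of [p] itself may vanish under [Phi]. This one specializes to the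
    leading coefficient of the image, under [Phi] and under every nearby [phi]. *)
Definition lead_at p : P := p`_(size (map_poly Phi p)).-1.

Lemma lead_atE p : Phi (lead_at p) = lead_coef (map_poly Phi p).
Proof. by rewrite lead_coefE coef_map. Qed.

Lemma sign_near_lead p :
  sign_near (fun phi => lead_coef (map_poly phi p) = phi (lead_at p)).
Proof.
by apply: sign_nearW (sign_near_size p) => phi h; rewrite lead_coefE h coef_map.
Qed.

(** Pseudo-division branches only on sizes and computes only with coefficients and leading
    coefficients, so it can be run once over [P], uniformly for all nearby [phi]. *)
Lemma sign_near_redivp_rec q n k qq r : exists k' qq' r',
  redivp_rec (map_poly Phi q) k (map_poly Phi qq) (map_poly Phi r) n
    = (k', map_poly Phi qq', map_poly Phi r') /\
  sign_near (fun phi =>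
    redivp_rec (map_poly phi q) k (map_poly phi qq) (map_poly phi r) n
    = (k', map_poly phi qq', map_poly phi r')).
Proof.
elim: n k qq r => [|n IHn] k qq r.
all: have nsz := sign_near_and (sign_near_size q) (sign_near_size r).
all: have nld := sign_near_and (sign_near_lead q) (sign_near_lead r).
all: rewrite /=; case: ifPn => szr.
1,3: by exists k, qq, r; split=> //; apply: sign_nearW nsz => phi [h1 h2];
  rewrite h1 h2 szr.
all: pose m := lead_at r *: 'X^(size (map_poly Phi r) - size (map_poly Phi q)).
all: pose qq1 := qq * (lead_at q)%:P + m.
all: pose r1 := r * (lead_at q)%:P - m * q.
all: have mE (F : rcfType) (f : {rmorphism P -> F}) :
  map_poly f m = f (lead_at r) *: 'X^(size (map_poly Phi r) - size (map_poly Phi q))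
  by rewrite /m -mul_polyC rmorphM /= map_polyC map_polyXn mul_polyC.
all: have qqE (F : rcfType) (f : {rmorphism P -> F}) :
  map_poly f qq1 = map_poly f qq * (f (lead_at q))%:P + map_poly f m
  by rewrite rmorphD rmorphM /= map_polyC.
all: have rE (F : rcfType) (f : {rmorphism P -> F}) :
  map_poly f r1 = map_poly f r * (f (lead_at q))%:P - map_poly f m * map_poly f q
  by rewrite rmorphB !rmorphM /= map_polyC.
- exists k.+1, qq1, r1; rewrite qqE rE mE !lead_atE; split=> //.
  apply: sign_near2 nsz nld => phi [h1 h2] [h3 h4].
  by rewrite h1 h2 h3 h4 (negbTE szr) qqE rE mE.
- have [k' [qq' [r' [E near]]]] := IHn k.+1 qq1 r1.
  exists k', qq', r'; split; first by rewrite -E qqE rE mE !lead_atE.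
  apply: sign_near2 near (sign_near_and nsz nld) => phi E' [[h1 h2] [h3 h4]].
  by rewrite h1 h2 h3 h4 (negbTE szr) -E' qqE rE mE.
Qed.

Lemma sign_near_redivp p q : exists k' qq' r',
  redivp (map_poly Phi p) (map_poly Phi q)
    = (k', map_poly Phi qq', map_poly Phi r') /\
  sign_near (fun phi => redivp (map_poly phi p) (map_poly phi q)
    = (k', map_poly phi qq', map_poly phi r')).
Proof.
have nsz := sign_near_and (sign_near_size p) (sign_near_size q).
rewrite !unlock; have [q0|q0] := boolP (map_poly Phi q == 0).
  exists 0%N, 0, p; rewrite rmorph0; split=> //.
  apply: sign_nearW nsz => phi [_ h].
  by rewrite -size_poly_eq0 h size_poly_eq0 q0 rmorph0.
have [k' [qq' [r' [E near]]]] :=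
  sign_near_redivp_rec q (size (map_poly Phi p)) 0 0 p.
exists k', qq', r'; split; first by rewrite -E rmorph0.
apply: sign_near2 near nsz => phi E' [h1 h2].
by rewrite -size_poly_eq0 h2 size_poly_eq0 (negbTE q0) -E' h1 rmorph0.
Qed.

Lemma sign_near_next_mod p q : exists r,
  next_mod (map_poly Phi p) (map_poly Phi q) = map_poly Phi r /\
  sign_near (fun phi =>
    next_mod (map_poly phi p) (map_poly phi q) = map_poly phi r).
Proof.
have [k [qq [r [E near]]]] := sign_near_redivp p q.
exists ((- lead_at q ^+ k) *: r).
have rE (F : rcfType) (f : {rmorphism P -> F}) :
    map_poly f ((- lead_at q ^+ k) *: r) = - f (lead_at q) ^+ k *: map_poly f r.
  by rewrite map_polyZ rmorphN rmorphXn.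
split; first by rewrite rE /next_mod /rscalp /rmodp E lead_atE.
apply: sign_near2 near (sign_near_lead q) => phi E' h.
by rewrite rE /next_mod /rscalp /rmodp E' h.
Qed.

(** The signed remainder sequence is lifted to [P] one remainder at a time, by induction on its
    length over [L]. *)
Lemma sign_near_mods p q : exists ms : seq {poly P},
  mods (map_poly Phi p) (map_poly Phi q) = map (map_poly Phi) ms /\
  sign_near (fun phi =>
    mods (map_poly phi p) (map_poly phi q) = map (map_poly phi) ms).
Proof.
have [n] := ubnP (size (mods (map_poly Phi p) (map_poly Phi q))).
elim: n p q => // n IHn p q; rewrite ltnS mods_rec => hn.
have nsz := sign_near_size p.
have [p0|p0] := boolP (map_poly Phi p == 0).
  exists [::]; split=> //; apply: sign_nearW nsz => phi h.
  by rewrite mods_rec -size_poly_eq0 h size_poly_eq0 p0.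
have [r [Er nr]] := sign_near_next_mod p q.
have [|ms [Ems nms]] := IHn q r.
  by apply: leq_trans hn; rewrite ?(negbTE p0) /= Er.
exists (p :: ms); split; first by rewrite Er Ems.
apply: sign_near2 nsz (sign_near_and nr nms) => phi h [h1 h2].
by rewrite mods_rec -size_poly_eq0 h size_poly_eq0 (negbTE p0) h1 h2.
Qed.

Lemma sign_near_changes (s : seq P) :
  sign_near (fun phi => changes (map phi s) = changes (map Phi s)).
Proof.
elim: s => [|a s IHs] /=; first exact: sign_nearT.
apply: sign_near2 IHs (sign_near_sgz (a * head 0 s)) => phi -> h.
congr (_ + _)%N.
have E (F : rcfType) (f : {rmorphism P -> F}) :
    (f a * head 0 (map f s) < 0) = (sgz (f (a * head 0 s)) == -1).
  by rewrite sgz_cp0 rmorphM; case: (s) => [|b t] //=; rewrite rmorph0.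
by rewrite !E h.
Qed.

Lemma sign_near_changes_poly (ms : seq {poly P}) :
  sign_near (fun phi => changes_poly (map (map_poly phi) ms) =
                        changes_poly (map (map_poly Phi) ms)).
Proof.
pose s1 := map lead_at ms.
(* These are the signs at minus infinity: the degree is odd exactly when the size is even, and a
   zero polynomial contributes 0 whatever the parity. *)
pose s2 := map (fun p => (-1) ^+ (~~ odd (size (map_poly Phi p))) * lead_at p) ms.
have nms : sign_near (fun phi => forall p, p \in ms ->
    size (map_poly phi p) = size (map_poly Phi p) /\
    lead_coef (map_poly phi p) = phi (lead_at p)).
  by apply: sign_near_all => p _;
    exact: sign_near_and (sign_near_size p) (sign_near_lead p).
apply: sign_near2 nms (sign_near_and (sign_near_changes s1) (sign_near_changes s2)).
move=> phi hms [h1 h2]; rewrite /changes_poly /changes_minfty /changes_pinfty.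
have e1 : [seq lead_coef i | i <- [seq map_poly phi i | i <- ms]] = map phi s1.
  by rewrite -!map_comp; apply/eq_in_map => p /hms[_] /=.
have e1' : [seq lead_coef i | i <- [seq map_poly Phi i | i <- ms]] = map Phi s1.
  by rewrite -!map_comp; apply/eq_in_map => p _ /=; rewrite lead_atE.
rewrite e1 e1' h1; congr (_%:Z - _); rewrite -!map_comp.
transitivity (changes (map phi s2)).
  congr changes; rewrite -map_comp; apply/eq_in_map => p /hms[hs hl] /=.
  by rewrite hs hl rmorphM rmorph_sign.
rewrite h2; congr changes; rewrite -map_comp; apply/eq_in_map => p _ /=.
by rewrite rmorphM rmorph_sign lead_atE.
Qed.

Lemma sign_near_taqR p q : sign_near (fun phi =>
  taqR (map_poly phi p) (map_poly phi q) = taqR (map_poly Phi p) (map_poly Phi q)).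
Proof.
have [ms [E near]] := sign_near_mods p (p^`() * q).
apply: sign_near2 near (sign_near_changes_poly ms) => phi E' h.
rewrite /taqR /changes_mods !deriv_map -!rmorphM [mods _ _]E' [in RHS]E.
exact: h.
Qed.

Lemma map_poly_comb (F : rcfType) (f : {rmorphism P -> F}) (sq : seq {poly P}) sc :
  poly_comb (map (map_poly f) sq) sc =
  map_poly f (\prod_(i < size sq) ((sq`_i) ^+ (comb_exp sc`_i))).
Proof.
rewrite /poly_comb rmorph_prod size_map; apply: eq_bigr => i _.
by rewrite rmorphXn (nth_map 0).
Qed.

Lemma sign_near_tvecR p (sq : seq {poly P}) : sign_near (fun phi =>
  forall i : 'I_(3 ^ size sq),
  taqR (map_poly phi p)
    (map (poly_comb (map (map_poly phi) sq)) (sg_tab (size sq)))`_i =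
  taqR (map_poly Phi p)
    (map (poly_comb (map (map_poly Phi) sq)) (sg_tab (size sq)))`_i).
Proof.
suff : sign_near (fun phi => forall i : 'I_(3 ^ size sq), i \in enum 'I_(3 ^ size sq) ->
  taqR (map_poly phi p)
    (map (poly_comb (map (map_poly phi) sq)) (sg_tab (size sq)))`_i =
  taqR (map_poly Phi p)
    (map (poly_comb (map (map_poly Phi) sq)) (sg_tab (size sq)))`_i).
  by apply: sign_nearW => phi h i; apply: h; rewrite mem_enum.
apply: sign_near_all => i _.
have hi : (i < size (sg_tab (size sq)))%N by rewrite size_sg_tab.
pose g := \prod_(j < size sq) ((sq`_j) ^+ (comb_exp (nth [::] (sg_tab (size sq)) i)`_j)).
apply: sign_nearW (sign_near_taqR p g) => phi.
by rewrite !(nth_map [::]) // !map_poly_comb.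
Qed.

(** The number of roots of [p] with a prescribed sign vector on [sq] is recovered from the Tarski
    queries of products of powers of the [sq], since the matrix [ctmat] relating the two is
    invertible. *)
Lemma sign_near_cvec p (sq : seq {poly P}) : sign_near (fun phi =>
  forall sigma, sigma \in sg_tab (size sq) ->
  constraints (rootsR (map_poly phi p)) (map (map_poly phi) sq) sigma =
  constraints (rootsR (map_poly Phi p)) (map (map_poly Phi) sq) sigma).
Proof.
apply: sign_nearW (sign_near_tvecR p sq) => phi h sigma hsigma.
pose cv (F : rcfType) (f : {rmorphism P -> F}) : 'rV[int]_(3 ^ size sq) :=
  \row_i (constraints (rootsR (map_poly f p)) (map (map_poly f) sq)
           (nth [::] (sg_tab (size sq)) i))%:~R.
pose tv (F : rcfType) (f : {rmorphism P -> F}) : 'rV[int]_(3 ^ size sq) :=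
  \row_i taqR (map_poly f p) (map (poly_comb (map (map_poly f) sq)) (sg_tab (size sq)))`_i.
have cvtv (F : rcfType) (f : {rmorphism P -> F}) : tv F f = cv F f *m ctmat (size sq).
  have := tvec_cvec (rootsR (map_poly f p)) (map (map_poly f) sq).
  by rewrite tvec_tvecR /tvecR /cvec size_map.
have : cv K phi *m ctmat (size sq) = cv L Phi *m ctmat (size sq).
  by rewrite -!cvtv; apply/rowP => i; rewrite !mxE.
(* [ctmat] has integer entries but is inverted over the rationals; injectivity of [intr] brings the
   equality back. *)
move=> /(congr1 (map_mx (intr : int -> rat))); rewrite !map_mxM => /(congr1
   (mulmx^~ (invmx (map_mx (intr : int -> rat) (ctmat (size sq)))))).
rewrite /= !mulmxK ?ctmat_unit // => /matrixP E.
have hi : (index sigma (sg_tab (size sq)) < 3 ^ size sq)%N.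
  by rewrite -size_sg_tab index_mem.
have := E 0 (Ordinal hi); rewrite !mxE /= nth_index //.
by move/intr_inj => /= /eqP; rewrite !intz eqz_nat => /eqP.
Qed.

Lemma mem_sg_tab (s : seq int) : (forall x, x \in s -> x \in [:: 1; -1; 0]) ->
  s \in sg_tab (size s).
Proof.
elim: s => // x s IHs h /=.
have xs : s \in sg_tab (size s) by apply: IHs => y ys; apply: h; rewrite inE ys orbT.
have := h x (mem_head _ _); rewrite !inE => /or3P[] /eqP->;
  by rewrite !mem_cat map_f ?orbT.
Qed.

Lemma constraints_gt0P (F : rcfType) (z : seq F) (sq : seq {poly F}) (sigma : seq int) :
  reflect (exists2 x, x \in z &
             forall i, (i < size sq)%N -> sgz (sq`_i).[x] = sigma`_i)
          (0 < constraints z sq sigma)%N.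
Proof.
rewrite /constraints lt0n sum_nat_seq_neq0; apply: (iffP hasP) => -[x xz].
  rewrite /= -lt0n => hx; exists x => // i hi; apply/eqP.
  have := all_prodn_gt0 hx => /(_ (Ordinal hi)); rewrite mem_index_enum /= => /(_ isT isT).
  by rewrite lt0b.
move=> h; exists x => //=; rewrite -lt0n prodn_gt0 // => i.
by rewrite lt0b h ?eqxx.
Qed.

(** Over [L] the root [a] makes the count for its own sign vector positive. The count is the same
    over [K], which yields [x]. *)
Lemma sign_near_root p (sq : seq {poly P}) (a : L) :
  map_poly Phi p != 0 -> root (map_poly Phi p) a ->
  sign_near (fun phi => exists x : K, forall h, h \in sq ->
    sgz (map_poly phi h).[x] = sgz (map_poly Phi h).[a]).
Proof.
move=> p0 pa; pose sigma := [seq sgz (map_poly Phi h).[a] | h <- sq].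
have hsigma : sigma \in sg_tab (size sq).
  rewrite -(size_map (fun h => sgz (map_poly Phi h).[a]) sq); apply: mem_sg_tab.
  by move=> _ /mapP[h _ ->]; rewrite !inE; case: sgzP.
apply: sign_nearW (sign_near_cvec p sq) => phi /(_ _ hsigma) E.
have : (0 < constraints (rootsR (map_poly Phi p)) (map (map_poly Phi) sq) sigma)%N.
  apply/constraints_gt0P; exists a; first by rewrite -roots_on_rootsR.
  by move=> i; rewrite size_map => hi; rewrite !(nth_map 0).
rewrite -E => /constraints_gt0P[x _ hx]; exists x => h hsq.
have := hx (index h sq); rewrite size_map index_mem => /(_ hsq).
by rewrite !(nth_map 0) ?index_mem // nth_index.
Qed.

(** By [bounding_polyP], simultaneous positivity is witnessed near plus infinity, near minus
    infinity, or at a root of the derivative of the product. The first two are conditions on leading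
    coefficients, the third falls under [sign_near_root]. *)
Lemma sign_near_pos (sq : seq {poly P}) (a : L) :
  (forall h, h \in sq -> 0 < (map_poly Phi h).[a]) ->
  sign_near (fun phi => exists x : K, forall h, h \in sq -> 0 < (map_poly phi h).[x]).
Proof.
move=> ha; pose sqL := map (map_poly Phi) sq.
have bigE (F : rcfType) (f : {rmorphism P -> F}) (p : {poly F} -> bool) :
    reflect (forall h, h \in sq -> p (map_poly f h))
            (\big[andb/true]_(q <- map (map_poly f) sq) p q).
  rewrite big_all; apply: (iffP allP) => h; first by move=> g gs; apply: h; exact: map_f.
  by move=> _ /mapP[g gs ->]; exact: h.
have ex : exists x, \big[andb/true]_(q <- sqL) (0 < q.[x]).
  by exists a; apply/(bigE L Phi (fun u => 0 < u.[a])).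
have ncase : sign_near (fun phi => forall h, h \in sq ->
    [/\ size (map_poly phi h) = size (map_poly Phi h),
        lead_coef (map_poly phi h) = phi (lead_at h) &
        sgz (phi (lead_at h)) = sgz (Phi (lead_at h))]).
  apply: sign_near_all => h _.
  apply: sign_near2 (sign_near_size h)
    (sign_near_and (sign_near_lead h) (sign_near_sgz (lead_at h))).
  by move=> phi h1 [h2 h3].
have case1 : (forall h, h \in sq -> 0 < lead_coef (map_poly Phi h)) ->
  sign_near (fun phi => exists x : K, forall h, h \in sq -> 0 < (map_poly phi h).[x]).
  move=> h0; apply: sign_nearW ncase => phi hn.
  have /bounding_polyP[x hx] :
    [\/ \big[andb/true]_(q <- map (map_poly phi) sq) (lead_coef q > 0),
      \big[andb/true]_(q <- map (map_poly phi) sq) ((-1)^+(size q).-1 * (lead_coef q) > 0) |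
   exists x, ((bounding_poly (map (map_poly phi) sq)).[x] == 0)
       && \big[andb/true]_(q <- map (map_poly phi) sq) (q.[x] > 0)].
    apply: Or31; apply/(bigE K phi (fun u => 0 < lead_coef u)) => h hs.
    have [_ e1 e2] := hn h hs; have := h0 h hs.
    by rewrite -lead_atE e1 -!sgz_cp0 e2.
  by exists x; exact/(bigE K phi (fun u => 0 < u.[x])).
have [h0|h0|[x /andP[bx /(bigE L Phi (fun u => 0 < u.[x])) hx]]] :=
  (bounding_polyP sqL).2 ex.
- by apply: case1; apply/(bigE L Phi (fun u => 0 < lead_coef u)).
- apply: sign_nearW ncase => phi hn.
  have /bounding_polyP[x hx] :
    [\/ \big[andb/true]_(q <- map (map_poly phi) sq) (lead_coef q > 0),
      \big[andb/true]_(q <- map (map_poly phi) sq) ((-1)^+(size q).-1 * (lead_coef q) > 0) |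
   exists x, ((bounding_poly (map (map_poly phi) sq)).[x] == 0)
       && \big[andb/true]_(q <- map (map_poly phi) sq) (q.[x] > 0)].
    apply: Or32; apply/(bigE K phi (fun u => 0 < (-1)^+(size u).-1 * lead_coef u)) => h hs.
    have [e0 e1 e2] := hn h hs.
    move/(bigE L Phi (fun u => 0 < (-1)^+(size u).-1 * lead_coef u)) : h0 => /(_ h hs).
    rewrite -lead_atE e1 e0 -!sgz_cp0 !sgzM e2.
    by rewrite -!(rmorph_sign phi) -!(rmorph_sign Phi) !rmorph_sign !sgzX !sgzN !sgz1.
  by exists x; exact/(bigE K phi (fun u => 0 < u.[x])).
- pose b := (\prod_(q <- sq) q)^`().
  have bE : map_poly Phi b = bounding_poly sqL.
    by rewrite /b /bounding_poly -deriv_map rmorph_prod big_map.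
  (* If the derivative vanishes identically, the product and hence every factor is constant;
     positivity at [x] is then positivity of the leading coefficients. *)
  have [b0|b0] := eqVneq (map_poly Phi b) 0.
    apply: case1 => h hs.
    have szprod : size (\prod_(u <- sqL) u) == 1%N.
      move: b0; rewrite bE /bounding_poly -derivn1 => /eqP; rewrite -derivn_poly0 => le1.
      rewrite eqn_leq le1 size_poly_gt0 prodf_seq_neq0.
      apply/allP => _ /mapP[g gs ->] /=.
      by apply: contraTneq (hx g gs) => ->; rewrite horner0 ltxx.
    move/size_prod_eq1: szprod => /(_ (map_poly Phi h) (map_f _ hs)) /eqP/size_poly1P.
    move=> [c c0 E]; have := hx h hs.
    by rewrite E lead_coefC hornerC.
  have rb : root (map_poly Phi b) x by rewrite bE; exact: bx.
  apply: sign_nearW (sign_near_root sq b0 rb) => phi [y hy]; exists y => h hs.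
  by rewrite -sgz_cp0 hy // sgz_cp0 hx.
Qed.

(** Either [a] is a root of some nonzero image, or every nonzero image has a strict sign at [a] and
    is made positive by [sg]. Images that are zero stay zero because sizes are preserved. *)
Theorem sign_near_horner (hs : seq {poly P}) (a : L) :
  sign_near (fun phi => exists x : K, forall h, h \in hs ->
    sgz (map_poly phi h).[x] = sgz (map_poly Phi h).[a]).
Proof.
have [[h [hhs h0 ha]]|noroot] := pselect (exists h,
    [/\ h \in hs, map_poly Phi h != 0 & root (map_poly Phi h) a]).
  exact: sign_near_root h0 ha.
pose sg h := if 0 < (map_poly Phi h).[a] then h else - h.
pose hs' := [seq sg h | h <- hs & map_poly Phi h != 0].
have nsz : sign_near (fun phi => forall h, h \in hs ->
    size (map_poly phi h) = size (map_poly Phi h)).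
  by apply: sign_near_all => h _; exact: sign_near_size.
have /sign_near_pos npos : forall h, h \in hs' -> 0 < (map_poly Phi h).[a].
  move=> _ /mapP[h + ->]; rewrite mem_filter /sg => /andP[h0 hhs].
  case: ifPn => //; rewrite -leNgt le_eqVlt => /orP[/eqP ha|ha].
    by case: noroot; exists h; split=> //; apply/eqP.
  by rewrite rmorphN hornerN oppr_gt0.
apply: sign_near2 nsz npos => phi hsz [x hx]; exists x => h hhs.
have [h0|h0] := eqVneq (map_poly Phi h) 0.
  have /eqP -> : map_poly phi h == 0 by rewrite -size_poly_eq0 hsz // h0 size_poly0.
  by rewrite h0 !horner0 !sgz0.
have := hx (sg h); rewrite map_f ?mem_filter ?h0 // /sg => /(_ isT).
case: ifPn => ha hpos; first by rewrite !gtr0_sgz.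
move: hpos; rewrite rmorphN hornerN oppr_gt0 => hneg.
move: ha; rewrite -leNgt le_eqVlt => /orP[/eqP ha|ha].
  by case: noroot; exists h; split=> //; apply/eqP.
by rewrite !ltr0_sgz.
Qed.

End Near.

(** * Polynomial rings in n variables, built one variable at a time *)

Fixpoint iter_poly (R : comNzRingType) (n : nat) : comNzRingType :=
  if n is m.+1 then {poly iter_poly R m} else R.

Section IterEval.
Variables (R S : comNzRingType) (phi : {rmorphism R -> S}) (c : nat -> S).

Fixpoint iter_eval n : {rmorphism iter_poly R n -> S} :=
  match n return {rmorphism iter_poly R n -> S} with
  | 0 => phi
  | m.+1 => horner_morph (fun x => mulrC (c m) (iter_eval m x))
  end.

Lemma iter_evalS n (p : {poly iter_poly R n}) :
  iter_eval n.+1 p = (map_poly (iter_eval n) p).[c n].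
Proof. by []. Qed.

End IterEval.

Fixpoint iter_const (R : comNzRingType) n : {rmorphism R -> iter_poly R n} :=
  match n return {rmorphism R -> iter_poly R n} with
  | 0 => idfun
  | m.+1 => (polyC : {rmorphism _ -> {poly iter_poly R m}}) \o iter_const R m
  end.

Fixpoint iter_map (R S : comNzRingType) (f : {rmorphism R -> S}) n :
    {rmorphism iter_poly R n -> iter_poly S n} :=
  match n return {rmorphism iter_poly R n -> iter_poly S n} with
  | 0 => f
  | m.+1 => map_poly (iter_map f m)
  end.

Lemma eq_iter_eval (R S : comNzRingType) (phi phi' : {rmorphism R -> S})
    (c c' : nat -> S) n : phi =1 phi' -> (forall i, (i < n)%N -> c i = c' i) ->
  iter_eval phi c n =1 iter_eval phi' c' n.
Proof.
move=> hphi; elim: n => [|n IHn] h x; first exact: hphi.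
rewrite !iter_evalS h //; congr _.[_].
by apply: eq_map_poly; apply: IHn => i /ltnW; exact: h.
Qed.

Lemma iter_eval_map (R S U : comNzRingType) (f : {rmorphism R -> S})
    (phi : {rmorphism S -> U}) (rho : {rmorphism R -> U}) (c : nat -> U) n :
  phi \o f =1 rho ->
  forall x, iter_eval phi c n (iter_map f n x) = iter_eval rho c n x.
Proof.
move=> h; elim: n => [|n IHn] x; first exact: h.
rewrite !iter_evalS; congr _.[_]; rewrite -map_poly_comp.
by apply: eq_map_poly => y; exact: IHn.
Qed.

Lemma iter_eval_const (R S : comNzRingType) (phi : {rmorphism R -> S}) (c : nat -> S) n x :
  iter_eval phi c n (iter_const R n x) = phi x.
Proof. by elim: n => //= n IHn; rewrite horner_morphC IHn. Qed.

Lemma iter_eval_var (R S : comNzRingType) (phi : {rmorphism R -> S}) (c : nat -> S) n i :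
  (i < n)%N -> exists x, iter_eval phi c n x = c i.
Proof.
elim: n => // n IHn; rewrite ltnS leq_eqVlt => /orP[/eqP->|/IHn[x <-]].
  by exists 'X; rewrite iter_evalS map_polyX hornerX.
by exists x%:P; rewrite iter_evalS map_polyC hornerC.
Qed.

Lemma iter_map_const (R S : comNzRingType) (f : {rmorphism R -> S}) n x :
  iter_map f n (iter_const R n x) = iter_const S n (f x).
Proof. by elim: n => //= n IHn; rewrite map_polyC /= IHn. Qed.

(** The coordinates of [a] are the images of the variables. *)
Lemma iter_poly_rmorphism (R S : comNzRingType) n (psi : {rmorphism iter_poly R n -> S}) :
  exists a : nat -> S, psi =1 iter_eval (psi \o iter_const R n) a n.
Proof.
elim: n psi => [|n IHn] psi; first by exists (fun _ => 0).
have [a ha] := IHn (psi \o (polyC : {rmorphism _ -> {poly iter_poly R n}})).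
exists (fun i => if i == n then psi 'X else a i) => p.
rewrite iter_evalS eqxx.
have -> : map_poly (iter_eval (psi \o iter_const R n.+1)
     (fun i => if i == n then psi 'X else a i) n) p =
   map_poly (psi \o polyC) p.
  by apply: eq_map_poly => x; rewrite ha; apply: eq_iter_eval => // i /ltn_eqF->.
have Ep : (map_poly polyC p).['X] = p by exact: comp_polyXr.
by rewrite map_poly_comp /= horner_map Ep.
Qed.

Lemma iter_poly_injective (R : comNzRingType) (f : R -> nat) n : injective f ->
  exists g : iter_poly R n -> nat, injective g.
Proof.
move=> fI; elim: n => [|n [g gI]]; first by exists f.
exists (fun p : {poly iter_poly R n} => pickle (map g p)) => p q.
move=> /(pcan_inj pickleK) /(inj_map gI) h; exact: val_inj.
Qed.

(** [cs] lists the scalar coefficients of all the [gs]; once these have preimages under [rho], the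
    polynomials are lifted coefficientwise. *)
Lemma iter_map_lift (K : comNzRingType) n (gs : seq (iter_poly K n)) :
  exists cs : seq K, forall (B : comNzRingType) (rho : {rmorphism B -> K}),
    (forall x, x \in cs -> exists b, rho b = x) ->
    forall g, g \in gs -> exists h, iter_map rho n h = g.
Proof.
elim: n gs => [|n IHn] gs; first by exists gs.
have [cs hcs] := IHn (flatten (map (@polyseq _) gs)).
exists cs => B rho hB g ggs.
have lift (x : iter_poly K n) : x \in polyseq g -> exists h, iter_map rho n h = x.
  move=> xg; apply: (hcs B rho hB); apply/flattenP.
  by exists (polyseq g) => //; exact: map_f.
pose v (x : iter_poly K n) : iter_poly B n :=
  if pselect (exists h, iter_map rho n h = x) is left e then projT1 (cid e) else 0.
have vE x : x \in polyseq g -> iter_map rho n (v x) = x.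
  by move=> /lift ex; rewrite /v; case: pselect => // e; case: cid.
exists (\poly_(i < size g) v g`_i); apply/polyP => i.
rewrite [LHS]coef_map coef_poly; case: ltnP => hi; first by apply: vE; exact: mem_nth.
by rewrite nth_default //; exact: rmorph0.
Qed.

(** For the last variable, [sign_near_horner] reduces the claim to the signs of finitely many
    polynomials in the preceding ones. Induction supplies those coordinates first. *)
Theorem sign_transfer (B : comNzRingType) (K L : rcfType)
    (rho : {rmorphism B -> K}) (psi : {rmorphism B -> L}) (a : nat -> L) :
  (forall b, sgz (rho b) = sgz (psi b)) ->
  forall n (S : seq (iter_poly B n)), exists c : nat -> K,
    forall s, s \in S -> sgz (iter_eval rho c n s) = sgz (iter_eval psi a n s).
Proof.
move=> hB; elim=> [|n IHn] S; first by exists (fun _ => 0) => s _; exact: hB.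
have [S' hS'] := sign_near_horner K (iter_eval psi a n) S (a n).
have [c hc] := IHn S'; have [x hx] := hS' _ hc.
pose c' i := if i == n then x else c i; exists c' => s sS.
have E : c' n = x by rewrite /c' eqxx.
rewrite !iter_evalS E -(hx _ sS); congr (sgz _.[_]).
by apply: eq_map_poly => y; apply: eq_iter_eval => // i /ltn_eqF; rewrite /c' => ->.
Qed.

(** * Hilbert's basis theorem *)

Definition is_ideal (R : comPzRingType) (I : set R) : Prop :=
  [/\ I 0, forall a b, I a -> I b -> I (a + b) & forall a b, I b -> I (a * b)].

(** Generation by [S] is expressed by minimality among ideals, which avoids explicit linear
    combinations. *)
Definition noetherian (R : comPzRingType) : Prop := forall I : set R, is_ideal I ->
  exists S : seq R, (forall y, y \in S -> I y) /\
    forall J, is_ideal J -> (forall y, y \in S -> J y) -> I `<=` J.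

Lemma field_noetherian (K : fieldType) : noetherian K.
Proof.
move=> I [I0 ID IM]; have [[x [Ix x0]]|nx] := pselect (exists x, I x /\ x != 0).
  exists [:: x]; split; first by move=> y; rewrite inE => /eqP->.
  move=> J [_ _ JM] /(_ x (mem_head _ _)) Jx y _.
  by rewrite -(mulfVK x0 y); exact: JM.
exists [::]; split=> // J [J0 _ _] _ x Ix; have [->//|x0] := eqVneq x 0.
by case: nx; exists x.
Qed.

Section Hilbert.
Variable R : comNzRingType.
Implicit Types (I J : set {poly R}).

(** For an ideal [I], these are the leading coefficients of its elements of degree [k], together
    with 0; bounding the size instead of fixing it keeps the set closed under addition. *)
Definition lead_ideal I (k : nat) : set R :=
  [set a | exists f : {poly R}, [/\ I f, (size f <= k.+1)%N & f`_k = a]].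

Lemma lead_ideal_is_ideal I k : is_ideal I -> is_ideal (lead_ideal I k).
Proof.
move=> [I0 ID IM]; split.
- by exists 0; rewrite size_poly0 coef0.
- move=> _ _ [f [If sf <-]] [g [Ig sg <-]]; exists (f + g); split; first exact: ID.
    by rewrite (leq_trans (size_polyD _ _)) // geq_max sf.
  by rewrite coefD.
- move=> a _ [f [If sf <-]]; exists (a%:P * f); split; first exact: IM.
    by rewrite mul_polyC (leq_trans (size_scale_leq _ _)).
  by rewrite coefCM.
Qed.

Lemma is_idealI I J : is_ideal I -> is_ideal J -> is_ideal (I `&` J).
Proof.
move=> [I0 ID IM] [J0 JD JM]; split=> //.
- by move=> a b [Ia Ja] [Ib Jb]; split; [exact: ID|exact: JD].
- by move=> a b [Ib Jb]; split; [exact: IM|exact: JM].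
Qed.

Lemma lead_ideal_leq I k l : is_ideal I -> (k <= l)%N ->
  lead_ideal I k `<=` lead_ideal I l.
Proof.
move=> [_ _ IM] kl _ [f [If sf <-]]; exists ('X^(l - k) * f); split.
- exact: IM.
- rewrite (leq_trans (size_polyMleq _ _)) // size_polyXn addSn /=.
  by rewrite (leq_trans (leq_add (leqnn _) sf)) // addnS subnK.
- by rewrite coefXnM ltnNge leq_subr /= subKn.
Qed.

Lemma lead_ideal_total I : is_ideal I -> is_ideal (\bigcup_k lead_ideal I k).
Proof.
move=> iI; split.
- by exists 0%N => //; case: (lead_ideal_is_ideal 0 iI).
- move=> a b [k _ ha] [l _ hb]; exists (maxn k l) => //.
  have [_ D _] := lead_ideal_is_ideal (maxn k l) iI.
  by apply: D; [apply: lead_ideal_leq ha|apply: lead_ideal_leq hb];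
    rewrite // (leq_maxl, leq_maxr).
- move=> a b [k _ hb]; exists k => //.
  by have [_ _ M] := lead_ideal_is_ideal k iI; exact: M.
Qed.

(** Subtracting an element of [I] and [J] with the same top coefficient lowers the size of an
    element of [I], so induction on the size applies. *)
Lemma lead_ideal_reduce I J :
  is_ideal I -> is_ideal J ->
  (forall k, lead_ideal I k `<=` lead_ideal (I `&` J) k) -> I `<=` J.
Proof.
move=> [I0 ID IM] [J0 JD JM] h f If; have [n] := ubnP (size f).
elim: n f If => // n IHn f If; rewrite ltnS => sf.
case: n => [|k] in IHn sf *.
  by move: sf; rewrite leqn0 size_poly_eq0 => /eqP->.
have [g [[Ig Jg] sg Eg]] : lead_ideal (I `&` J) k f`_k by apply: h; exists f.
have Ng : I (- g) by rewrite -mulN1r; exact: IM.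
have Jfg : J (f - g).
  apply: IHn; first exact: ID.
  rewrite ltnS; apply/leq_sizeP => j; rewrite leq_eqVlt => /orP[/eqP<-|kj].
    by rewrite coefB Eg subrr.
  by rewrite coefB !nth_default ?subrr // (leq_trans _ kj).
by rewrite -(subrK g f); exact: JD.
Qed.

Lemma lead_ideal_gens I k (s : seq R) : is_ideal I ->
  (forall a, a \in s -> lead_ideal I k a) ->
  exists G : seq {poly R}, [/\ (forall f, f \in G -> I f),
    (forall f, f \in G -> (size f <= k.+1)%N) &
     forall a, a \in s -> exists2 f, f \in G & f`_k = a].
Proof.
move=> iI; elim: s => [|a s IHs] h; first by exists [::].
have [G [G1 G2 G3]] := IHs (fun b bs => h b (@mem_behead _ (a :: s) b bs)).
have [f [If sf fa]] := h a (mem_head _ _).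
exists (f :: G); split.
- by move=> g; rewrite inE => /orP[/eqP->|/G1].
- by move=> g; rewrite inE => /orP[/eqP->|/G2].
- move=> b; rewrite inE => /orP[/eqP->|/G3[g gG <-]].
    by exists f; rewrite ?mem_head.
  by exists g => //; rewrite inE gG orbT.
Qed.

(** Generators of the union of all leading ideals are attained in one degree [d] by [G], which
    serves all degrees from [d] on. Each of the finitely many lower degrees gets its own list. *)
Theorem hilbert_basis : noetherian R -> noetherian {poly R}.
Proof.
move=> nR I iI.
have [s [sI sgen]] := nR _ (lead_ideal_total iI).
have [d hd] : exists d, forall a, a \in s -> lead_ideal I d a.
  elim: (s) sI => [|a t IHt] h; first by exists 0%N.
  have [d hd] := IHt (fun b bt => h b (@mem_behead _ (a :: t) b bt)).
  have [k _ hk] := h a (mem_head _ _); exists (maxn d k) => b.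
  rewrite inE => /orP[/eqP->|/hd].
    by apply: lead_ideal_leq hk; rewrite // leq_maxr.
  by apply: lead_ideal_leq; rewrite // leq_maxl.
have [G [GI Gs Ga]] := lead_ideal_gens iI hd.
have low k : exists H : seq {poly R}, [/\ (forall f, f \in H -> I f),
    (forall f, f \in H -> (size f <= k.+1)%N) &
    forall M, is_ideal M -> (forall f, f \in H -> M f`_k) -> lead_ideal I k `<=` M].
  have [t [tI tgen]] := nR _ (lead_ideal_is_ideal k iI).
  have [H [HI Hs Ha]] := lead_ideal_gens iI tI.
  exists H; split=> // M iM hM; apply: tgen => // a /Ha[f fH <-]; exact: hM.
have [Hf hH] := choice low.
exists (G ++ flatten [seq Hf k | k <- iota 0 d]); split.
  move=> f; rewrite mem_cat => /orP[/GI//|/flattenP[_ /mapP[k _ ->]]].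
  by have [h _ _] := hH k; exact: h.
move=> J iJ JS; apply: lead_ideal_reduce => // k.
have iM := lead_ideal_is_ideal k (is_idealI iI iJ).
have [dk|kd] := leqP d k.
  move=> a ha; apply: (sgen _ iM); last by exists k.
  move=> _ /Ga[f fG <-]; apply: lead_ideal_leq dk _ _ => //; first exact: is_idealI.
  exists f; split=> //; last exact: Gs.
  by split; [exact: GI|apply: JS; rewrite mem_cat fG].
have [h1 h2 h3] := hH k; apply: h3 => // f fH; exists f; split=> //; last exact: h2.
split; first exact: h1.
apply: JS; rewrite mem_cat; apply/orP; right; apply/flattenP; exists (Hf k) => //.
by apply: map_f; rewrite mem_iota.
Qed.

End Hilbert.

Lemma iter_poly_noetherian (R : comNzRingType) n : noetherian R ->
  noetherian (iter_poly R n).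
Proof. by move=> nR; elim: n => //= n; exact: hilbert_basis. Qed.

(** Without a maximal element, iterating a choice of strictly larger members gives a chain. Its
    union is finitely generated, so the chain stops growing, a contradiction. *)
Lemma noetherian_maximal (R : comPzRingType) (P : set (set R)) (I0 : set R) :
  noetherian R -> (forall I, P I -> is_ideal I) -> P I0 ->
  exists2 I, P I & forall J, P J -> I `<=` J -> J `<=` I.
Proof.
move=> nR iP PI0; apply: contrapT => nmax.
have next (I : set R) : exists J, P I -> [/\ P J, I `<=` J & ~ J `<=` I].
  have [PI|] := pselect (P I); last by exists I.
  apply: contrapT => nJ; apply: nmax; exists I => // J PJ IJ.
  by apply: contrapT => nJI; apply: nJ; exists J.
have [f hf] := choice next.
pose U k := iter k f I0.
have PU k : P (U k) by elim: k => //= k /hf[].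
have leU k l : (k <= l)%N -> U k `<=` U l.
  move=> /subnK <-; elim: (l - k)%N => //= j IHj.
  by apply: (subset_trans IHj); case: (hf _ (PU (j + k)%N)).
have iU : is_ideal (\bigcup_k U k).
  split.
  - by exists 0%N => //; case: (iP _ (PU 0%N)).
  - move=> a b [k _ ha] [l _ hb]; exists (maxn k l) => //.
    have [_ D _] := iP _ (PU (maxn k l)).
    by apply: D; [apply: leU ha|apply: leU hb]; rewrite (leq_maxl, leq_maxr).
  - by move=> a b [k _ hb]; exists k => //; have [_ _ M] := iP _ (PU k); exact: M.
have [s [sU sgen]] := nR _ iU.
have [k hk] : exists k, forall y, y \in s -> U k y.
  elim: (s) sU => [|a t IHt] h; first by exists 0%N.
  have [d hd] := IHt (fun b bt => h b (@mem_behead _ (a :: t) b bt)).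
  have [k _ ka] := h a (mem_head _ _); exists (maxn d k) => b.
  rewrite inE => /orP[/eqP->|/hd]; first by apply: leU ka; rewrite leq_maxr.
  by apply: leU; rewrite leq_maxl.
have := sgen _ (iP _ (PU k)) hk; have [_ _ nsub] := hf _ (PU k).
by move=> sub; apply: nsub => x Ux; apply: sub; exists k.+1.
Qed.

(** * The real Nullstellensatz *)

Definition real_subset (R : pzRingType) (p : set R) : Prop :=
  forall s : seq R, p (\sum_(x <- s) x ^+ 2) -> forall x, x \in s -> p x.

Section SumsOfSquares.
Variables (R : comNzRingType) (p : set R) (pp : prime_ideal p) (rp : real_subset p).

Definition sos_mod : set R := [set x | exists s : seq R, p (x - \sum_(y <- s) y ^+ 2)].

Let p0 : p 0. Proof. by case: pp. Qed.
Let pD a b : p a -> p b -> p (a + b). Proof. by case: pp => _ _ h _ _; exact: h. Qed.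
Let pM a b : p b -> p (a * b). Proof. by case: pp => _ _ _ h _; exact: h. Qed.

Lemma sos_mod_sqr x : sos_mod (x ^+ 2).
Proof. by exists [:: x]; rewrite big_seq1 subrr. Qed.

Lemma sos_modD x y : sos_mod x -> sos_mod y -> sos_mod (x + y).
Proof.
move=> [s hs] [t ht]; exists (s ++ t).
by rewrite big_cat opprD addrACA; exact: pD.
Qed.

Lemma sos_modM x y : sos_mod x -> sos_mod y -> sos_mod (x * y).
Proof.
move=> [s hs] [t ht]; exists [seq u * v | u <- s, v <- t].
have -> : \sum_(z <- [seq u * v | u <- s, v <- t]) z ^+ 2 =
    (\sum_(u <- s) u ^+ 2) * (\sum_(v <- t) v ^+ 2).
  rewrite big_allpairs_dep big_distrlr /=; apply: eq_bigr => u _.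
  by apply: eq_bigr => v _; rewrite exprMn.
set S := \sum_(u <- s) _ in hs *; set T := \sum_(v <- t) _ in ht *.
have -> : x * y - S * T = y * (x - S) + S * (y - T) by ring.
by apply: pD; exact: pM.
Qed.

Lemma sos_mod_real x d : sos_mod x -> p (x + d ^+ 2) -> p d.
Proof.
move=> [s hs] h; apply: (rp (s := d :: s)); last exact: mem_head.
rewrite big_cons; set S := \sum_(u <- s) _ in hs *.
have -> : d ^+ 2 + S = (x + d ^+ 2) + (-1) * (x - S) by ring.
by apply: pD => //; exact: pM.
Qed.

End SumsOfSquares.

Section SosCone.
Variables (W Q : comNzRingType) (chi : {rmorphism W -> Q}) (p : set Q).
Hypotheses (pp : prime_ideal p) (rp : real_subset p).
Variables (C : closedFieldType) (j : {rmorphism W -> C}).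
Hypothesis jker : forall w, j w = 0 <-> p (chi w).

Definition sos_cone : set C :=
  [set x | exists w d, [/\ sos_mod p (chi w), j d != 0 & x = j w / j d ^+ 2]].

Lemma sos_cone_sqr w : sos_cone (j w ^+ 2).
Proof.
exists (w ^+ 2), 1; rewrite !rmorphXn rmorph1 oner_neq0 expr1n divr1.
by split=> //; exact: sos_mod_sqr.
Qed.

Lemma sos_cone_cone : cone sos_cone.
Proof.
split.
- by have := sos_cone_sqr 1; rewrite rmorph1 expr1n.
- move=> _ _ [w [d [sw d0 ->]]] [w' [d' [sw' d'0 ->]]].
  exists (w * d' ^+ 2 + w' * d ^+ 2), (d * d'); split.
  + rewrite rmorphD !rmorphM; apply: sos_modD => //; apply: sos_modM => //;
      exact: sos_mod_sqr.
  + by rewrite rmorphM mulf_neq0.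
  + by rewrite rmorphD !rmorphM; field; apply/andP.
- move=> _ _ [w [d [sw d0 ->]]] [w' [d' [sw' d'0 ->]]].
  exists (w * w'), (d * d'); split.
  + by rewrite rmorphM; exact: sos_modM.
  + by rewrite rmorphM mulf_neq0.
  + by rewrite !rmorphM; field; apply/andP.
- move=> _ [w [d [sw d0 ->]]]; have [E|E] := eqVneq (j w) 0.
    by rewrite E mul0r invr0; have := sos_cone_sqr 0; rewrite rmorph0 expr0n.
  exists (w * d ^+ 2), w; split=> //.
  + by rewrite rmorphM rmorphXn; apply: sos_modM => //; exact: sos_mod_sqr.
  + by rewrite !rmorphM; field; apply/andP.
- move=> _ _ [w [d [sw d0 ->]]] [w' [d' [sw' d'0 ->]]].
  exists ((w * d' ^+ 2 - w' * d ^+ 2) ^+ 2), ((d * d') ^+ 2); split.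
  + by rewrite rmorphXn; exact: sos_mod_sqr.
  + by rewrite rmorphXn rmorphM expf_neq0 // mulf_neq0.
  + by rewrite rmorphXn rmorphB !rmorphM; field; apply/andP.
(* Here [w + d^2] would be in [p] modulo [chi], and reality would put [chi d] into [p], against
   [j d != 0]. *)
- move=> [w [d [sw d0 E]]]; case/negP: (d0); apply/eqP/jker.
  apply: (sos_mod_real pp rp sw); rewrite -rmorphXn -rmorphD; apply/jker.
  have Ew : j w = - j d ^+ 2 by rewrite -mulN1r E mulfVK // expf_neq0.
  by rewrite rmorphD rmorphXn Ew addNr.
Qed.

Lemma sos_cone_real_closed : exists (L : rcfType) (psi : {rmorphism W -> L}),
  (forall w, psi w = 0 <-> p (chi w)) /\
  (forall w, sos_mod p (chi w) -> 0 <= psi w).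
Proof.
have [L [jL hL]] := cone_real_closed sos_cone_cone.
have n4 : jL 4%:R != 0 by rewrite fmorph_eq0 pnatr_eq0.
(* The image of [W] lies in [L], since [w] is a quarter of the difference of the squares of [w + 1]
   and [w - 1]. *)
have lift w : exists y, jL y = j w.
  have [y1 _ E1] := hL _ (sos_cone_sqr (w + 1)).
  have [y2 _ E2] := hL _ (sos_cone_sqr (w - 1)).
  exists ((y1 - y2) / 4%:R); rewrite rmorphM rmorphB fmorphV E1 E2.
  rewrite rmorphD rmorphB rmorph1; apply: (canLR (mulfK n4)).
  by rewrite rmorph_nat; ring.
have [psi hpsi] := choice lift.
have psiB : zmod_morphism psi.
  by move=> x y; apply: (fmorph_inj jL); rewrite rmorphB !hpsi rmorphB.
have psiM : monoid_morphism psi.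
  split; first by apply: (fmorph_inj jL); rewrite hpsi !rmorph1.
  by move=> x y; apply: (fmorph_inj jL); rewrite rmorphM !hpsi rmorphM.
pose psi' : {rmorphism W -> L} := HB.pack psi
  (GRing.isZmodMorphism.Build _ _ psi psiB)
  (GRing.isMonoidMorphism.Build _ _ psi psiM).
exists L, psi'; split=> w.
  split=> [h|/jker h]; first by apply/jker; rewrite -hpsi [psi w]h rmorph0.
  by apply: (fmorph_inj jL); rewrite [LHS]hpsi h rmorph0.
move=> sw; have [|y y0 E] := hL (j w).
  by exists w, 1; rewrite rmorph1 oner_neq0 expr1n divr1.
by have -> : psi' w = y by apply: (fmorph_inj jL); rewrite [LHS]hpsi.
Qed.

End SosCone.

Theorem real_nullstellensatz (K : rcfType) m (p : set (iter_poly K m)) delta :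
  prime_ideal p -> real_subset p -> ~ p delta ->
  exists phi : {rmorphism iter_poly K m -> K},
    [/\ forall c, phi (iter_const K m c) = c, forall x, p x -> phi x = 0 &
        phi delta != 0].
Proof.
move=> pp rp ndelta; have [p0 p1 pD pM pP] := pp.
have [|G [Gp Ggen]] := @iter_poly_noetherian K m (@field_noetherian K) p.
  by split.
have [cs hcs] := iter_map_lift (delta :: G).
(* [B] is a polynomial ring over the integers whose image under [rho] is the subring of [K]
   generated by [cs]; this makes [W] countable. *)
pose l := size cs; pose B := iter_poly int l.
pose rho : {rmorphism B -> K} := iter_eval (intr : {rmorphism int -> K}) (nth 0 cs) l.
have rho_surj x : x \in cs -> exists b, rho b = x.
  move=> xcs; rewrite -(nth_index 0 xcs) /rho.
  by apply: iter_eval_var; rewrite index_mem.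
pose chi := iter_map rho m.
have lift := hcs _ _ rho_surj.
pose W := iter_poly B m.
have [f fI] : exists f : W -> nat, injective f.
  have [f0 f0I] := @iter_poly_injective int pickle l (pcan_inj pickleK).
  exact: iter_poly_injective f0I.
have qprime : prime_ideal [set w : W | p (chi w)].
  split; rewrite /= ?rmorph0 ?rmorph1 //.
  - by move=> a b; rewrite /= rmorphD; exact: pD.
  - by move=> a b; rewrite /= rmorphM; exact: pM.
  - by move=> a b; rewrite /= rmorphM; exact: pP.
have [C [j jker]] := prime_quotient_closed_field fI qprime.
have [L [psi [psi0 psi_ge0]]] := sos_cone_real_closed pp rp jker.
pose base : {rmorphism B -> L} := psi \o iter_const B m.
have pconst x : x != 0 -> ~ p (iter_const K m x).
  move=> x0 px; apply: p1.
  by rewrite -(rmorph1 (iter_const K m)) -(mulVf x0) rmorphM; exact: pM.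
(* A positive element of [K] is a square and a unit: its constant polynomial is thus a square, hence
   nonnegative under [psi], and lies outside the proper ideal [p]. *)
have base_gt0 b : 0 < rho b -> 0 < base b.
  move=> b0; rewrite lt_neqAle eq_sym; apply/andP; split.
    apply/eqP => /psi0; rewrite /chi iter_map_const; apply: pconst.
    by rewrite gt_eqF.
  apply: psi_ge0; rewrite /chi iter_map_const -(sqr_sqrtr (ltW b0)) rmorphXn.
  exact: sos_mod_sqr.
have sgB b : sgz (rho b) = sgz (base b).
  have [b0|b0|b0] := sgzP (rho b).
  - suff -> : base b = 0 by rewrite sgz0.
    by apply/psi0; rewrite /chi iter_map_const b0 rmorph0.
  - by rewrite gtr0_sgz ?base_gt0.
  - have := base_gt0 (- b); rewrite !rmorphN !oppr_gt0 => /(_ b0) h.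
    by rewrite ltr0_sgz.
have [a ha] := iter_poly_rmorphism psi.
have liftG : forall g, exists h : W, g \in delta :: G -> chi h = g.
  move=> g; have [gG|gG] := boolP (g \in delta :: G).
    by have [h hg] := lift _ gG; exists h.
  by exists 0.
have [li hli] := choice liftG.
(* Keeping the signs of the lifts of [delta] and of the generators [G] makes [G] vanish at [c] while
   [delta] does not. *)
have [c hc] := sign_transfer a sgB (map li (delta :: G)).
pose phi := iter_eval (idfun : {rmorphism K -> K}) c m.
have phiE g : g \in delta :: G -> sgz (phi g) = sgz (psi (li g)).
  move=> gG; rewrite -{1}(hli _ gG) /phi /chi (@iter_eval_map _ _ _ _ _ rho) //.
  by rewrite hc ?map_f // [in RHS]ha.
exists phi; split.
- by move=> x; rewrite /phi iter_eval_const.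
- apply: Ggen; first split.
  + exact: rmorph0.
  + by move=> x y hx hy; rewrite rmorphD hx hy addr0.
  + by move=> x y hy; rewrite rmorphM hy mulr0.
  move=> y yG; have yG' : y \in delta :: G by rewrite inE yG orbT.
  apply/eqP; rewrite -sgz_eq0 phiE // sgz_eq0; apply/eqP/psi0.
  by rewrite hli //; exact: Gp.
- have dG : delta \in delta :: G := mem_head _ _.
  rewrite -sgz_eq0 phiE // sgz_eq0; apply/eqP => /psi0.
  by rewrite hli.
Qed.

(** * Real left ideals of matrix rings *)

Section RowModule.
Variables (Q : comNzRingType) (n : nat) (I : set 'M[Q]_n).
Hypothesis lI : left_ideal I.

(** For positive [n] these are the rows of the elements of [I]; quantifying over columns [w] makes
    the module laws immediate. *)
Definition row_module : set 'rV[Q]_n := [set v | forall w : 'cV[Q]_n, I (w *m v)].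

Let I0 : I 0. Proof. by case: lI. Qed.
Let ID F G : I F -> I G -> I (F + G). Proof. by case: lI => _ h _; exact: h. Qed.
Let IM F G : I G -> I (F *m G). Proof. by case: lI => _ _ h; exact: h. Qed.

Lemma row_module0 : row_module 0.
Proof. by move=> w; rewrite mulmx0. Qed.

Lemma row_moduleD v w : row_module v -> row_module w -> row_module (v + w).
Proof. by move=> hv hw x; rewrite mulmxDr; exact: ID. Qed.

Lemma row_moduleZ a v : row_module v -> row_module (a *: v).
Proof. by move=> hv x; rewrite -scalemxAr -mul_scalar_mx; exact: IM. Qed.

Lemma row_moduleB v w : row_module v -> row_module w -> row_module (v - w).
Proof. by move=> hv hw; rewrite -scaleN1r; apply: row_moduleD => //; exact: row_moduleZ. Qed.

Lemma row_module_sum (T : finType) (v : T -> 'rV[Q]_n) :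
  (forall i, row_module (v i)) -> row_module (\sum_i v i).
Proof. by move=> h; apply: big_ind => //; [exact: row_module0|exact: row_moduleD]. Qed.

Lemma row_moduleP G : I G <-> forall i, row_module (row i G).
Proof.
split=> [IG i w|h]; first by rewrite rowE mulmxA; exact: IM.
rewrite -[G]mul1mx mx1_sum_delta mulmx_suml; apply: big_ind => //.
by move=> i _; rewrite -(mul_delta_mx (0 : 'I_1)) -mulmxA -rowE; exact: h.
Qed.

Hypothesis rI : real_ideal I.
Hypothesis n0 : (0 < n)%N.

(** Each [h i] is placed in the first row of a square matrix [e *m h i]. Since [e^T *m e] is 1, the
    sum of squares is unchanged and reality of [I] applies. *)
Lemma row_module_real k (h : 'I_k -> 'rV[Q]_n) :
  I (\sum_(i < k) (h i)^T *m h i) -> forall i, row_module (h i).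
Proof.
move=> hI; pose i0 := Ordinal n0.
pose e : 'cV[Q]_n := delta_mx i0 0.
have ee : e^T *m e = 1%:M.
  by rewrite /e trmx_delta mul_delta_mx; apply/matrixP => a b; rewrite !mxE !ord1.
have := rI (k := k) (H := fun i => e *m h i); move=> H i w.
have -> : w *m h i = (w *m e^T) *m (e *m h i).
  by rewrite -mulmxA [e^T *m _]mulmxA ee mul1mx.
apply: IM; apply: H => {i w}; exists (\sum_(i < k) (h i)^T *m h i) => //.
exists 0 => //; rewrite trmx0 addr0; apply: eq_bigr => i _.
by rewrite trmx_mul -mulmxA [e^T *m _]mulmxA ee mul1mx.
Qed.

End RowModule.

Section PrimeOfRealModule.
Variables (Q : comNzRingType) (n : nat) (I : set 'M[Q]_n).
Hypotheses (lI : left_ideal I) (rI : real_ideal I) (n0 : (0 < n)%N).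
Hypothesis nQ : noetherian Q.
Local Notation N := (row_module I).

Let transporter (f : 'rV[Q]_n) : set Q := [set x | N (x *: f)].

Lemma transporter_ideal f : is_ideal (transporter f).
Proof.
split.
- by rewrite /transporter /= scale0r; exact: row_module0.
- by move=> a b; rewrite /transporter /= scalerDl; exact: row_moduleD.
- by move=> a b; rewrite /transporter /= -scalerA; exact: row_moduleZ.
Qed.

(** As for associated primes: a maximal transporter of a multiple of [f0] outside [N] is prime,
    because multiplying that vector further by [y] outside it cannot enlarge the transporter. *)
Lemma exists_prime_transporter f0 : ~ N f0 ->
  exists a, prime_ideal (transporter (a *: f0)).
Proof.
move=> nf0.
pose P := [set J : set Q | exists2 a, ~ N (a *: f0) & J = transporter (a *: f0)].
have [||_ [a na ->] amax] := @noetherian_maximal Q P (transporter (1 *: f0)) nQ.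
- by move=> _ [a _ ->]; exact: transporter_ideal.
- by exists 1; rewrite ?scale1r.
have [t0 tD tM] := transporter_ideal (a *: f0).
exists a; split=> //; first by rewrite /transporter /= scale1r.
move=> x y hxy; have [|ny] := pselect (transporter (a *: f0) y); first by right.
left; apply: (amax (transporter ((y * a) *: f0))).
- by exists (y * a) => //; rewrite -scalerA.
- move=> z hz; rewrite /transporter /=.
  have -> : z *: ((y * a) *: f0) = y *: (z *: (a *: f0)).
    by rewrite !scalerA; congr (_ *: _); ring.
  exact: row_moduleZ.
- by move: hxy; rewrite /transporter /= !scalerA mulrA.
Qed.

Variables (f : 'rV[Q]_n).
Hypothesis pf : prime_ideal (transporter f).
Local Notation p := (transporter f).

(** The matrices [(x f)^T (x f)] add up to [f^T] times the sum of the [x^2] times [f], which is in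
    [I] when that sum is in [p]. *)
Lemma transporter_real : real_subset p.
Proof.
move=> s hs x xs; pose t := in_tuple s; pose h i := tnth t i *: f.
have hI : I (\sum_(i < size s) (h i)^T *m h i).
  have -> : \sum_(i < size s) (h i)^T *m h i =
      f^T *m ((\sum_(y <- s) y ^+ 2) *: f).
    rewrite -scalemxAr scaler_suml [RHS](big_tnth _ _ s).
    apply: eq_bigr => i _; apply/matrixP => a b.
    by rewrite /h !mxE !big_ord1 !mxE; ring.
  exact: hs.
have [i ->] := seq_tnthP xs.
exact: (row_module_real lI rI n0 hI i).
Qed.

(* If [c f = v + q] with [v] in [N] and [q] in [p Q^n], then the rows of [q^T q]
   lie in [p q], which is contained in [N]; as [I] is real, [q] is in [N]. *)
Lemma transporter_generic c (v q : 'rV[Q]_n) :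
  N v -> (forall l, p (q 0 l)) -> c *: f = v + q -> p c.
Proof.
move=> Nv pq E; rewrite /transporter /= E; apply: row_moduleD => //.
have Npq x : p x -> N (x *: q).
  move=> px; have -> : q = c *: f - v by rewrite E addrC addKr.
  rewrite scalerBr; apply: row_moduleB => //; last exact: row_moduleZ.
  by rewrite scalerA mulrC -scalerA; exact: row_moduleZ.
apply: (@row_module_real _ _ _ lI rI n0 1 (fun _ => q) _ ord0).
rewrite big_ord1; apply/row_moduleP => // l.
have -> : row l (q^T *m q) = q 0 l *: q.
  by apply/rowP => b; rewrite !mxE big_ord1 !mxE.
exact: Npq.
Qed.

Let p0 : p 0. Proof. by case: pf. Qed.
Let p1 : ~ p 1. Proof. by case: pf. Qed.
Let pM a b : p b -> p (a * b). Proof. by case: pf => _ _ _ h _; exact: h. Qed.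
Let pP a b : p (a * b) -> p a \/ p b. Proof. by case: pf => _ _ _ _ h; exact: h. Qed.

(* The matrix with rows [M] has scalar matrix [D] in the columns [g]. *)
Definition reduced (T : finType) (M : T -> 'rV[Q]_n) (g : T -> 'I_n) (D : Q) : Prop :=
  [/\ forall i, N (M i), ~ p D & forall i k, M i 0 (g k) = D *+ (i == k)].

(** Elimination without division: for a reduced [M], the result has zeros in the columns [g]. *)
Definition reduce (T : finType) (M : T -> 'rV[Q]_n) (g : T -> 'I_n) (D : Q)
  (v : 'rV[Q]_n) : 'rV[Q]_n := D *: v - \sum_i v 0 (g i) *: M i.

(** The number of rows is at most [n] since [g] is injective. For a maximal number, a reduced vector
    of [N] with an entry outside [p] would provide one more row. *)
Lemma exists_maximal_reduced : exists (T : finType) (M : T -> 'rV[Q]_n) g D,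
  reduced M g D /\ forall v, N v -> forall l, p (reduce M g D v 0 l).
Proof.
pose P r := `[< exists (T : finType) (M : T -> 'rV[Q]_n) g D,
   reduced M g D /\ #|T| = r >].
have P0 : exists r, P r.
  exists 0%N; apply/asboolP; exists (void : finType), (of_void _), (of_void _), 1.
  split; last exact: card_void.
  by split=> // -[].
have Pn r : P r -> (r <= n)%N.
  move=> /asboolP[T [M [g [D [[_ nD Mg] <-]]]]].
  rewrite -[X in (_ <= X)%N]card_ord; apply: (leq_card g) => i k gik.
  apply/eqP/negPn/negP => /negbTE nik; apply: nD.
  by have := Mg i i; rewrite gik Mg nik eqxx mulr0n mulr1n => <-.
have := ex_maxnP P0 Pn => -[r /asboolP[T [M [g [D [[NM nD Mg] Tr]]]]] rmax].
exists T, M, g, D; split=> // v Nv l; apply: contrapT => nl.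
set w := reduce M g D v in nl.
have Nw : N w.
  apply: row_moduleB => //; first exact: row_moduleZ.
  by apply: row_module_sum => // i; exact: row_moduleZ.
have wg k : w 0 (g k) = 0.
  rewrite !mxE summxE (bigD1 k) //= big1 => [|i ik]; last first.
    by rewrite mxE Mg (negbTE ik) mulr0.
  by rewrite mxE Mg eqxx addr0 mulrC subrr.
clearbody w.
(* Cross-multiplication clears column [l] in the old rows, and [w] is already zero in the columns
   [g]; the common pivot is [w 0 l * D], outside the prime [p]. *)
pose M' (a : option T) := if a is Some i then w 0 l *: M i - M i 0 l *: w else D *: w.
pose g' (a : option T) := if a is Some i then g i else l.
suff : P r.+1 by move/rmax; rewrite ltnn.
apply/asboolP; exists (option T : finType), M', g', (w 0 l * D).
split; last by rewrite card_option Tr.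
split.
- move=> [i|] /=; last exact: row_moduleZ.
  by apply: row_moduleB => //; exact: row_moduleZ.
- by move/pP => [].
- move=> [i|] [k|] /=; rewrite !mxE ?wg ?Mg ?mulr0 ?subr0 //.
  + by rewrite mulrnAr.
  + by rewrite mulrC subrr mulr0n.
  + by rewrite mulrC mulr1n.
Qed.

Theorem separating_functional : exists delta, ~ p delta /\
  forall (K : fieldType) (phi : {rmorphism Q -> K}),
    (forall x, p x -> phi x = 0) -> phi delta != 0 ->
    exists u : 'cV[K]_n, (forall v, N v -> map_mx phi v *m u = 0) /\
                         map_mx phi f *m u != 0.
Proof.
have [T [M [g [D [[NM nD Mg] Mmax]]]]] := exists_maximal_reduced.
(* If all entries of the reduced [f] were in [p], then [D *: f] would be in N + p Q^n, and
   [transporter_generic] would put [D] into [p]. *)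
have [l nl] : exists l, ~ p (reduce M g D f 0 l).
  apply: contrapT => nl; apply: nD.
  apply: (@transporter_generic D (\sum_i f 0 (g i) *: M i) (reduce M g D f)).
  - by apply: row_module_sum => // i; exact: row_moduleZ.
  - by move=> l; apply: contrapT => h; apply: nl; exists l.
  - by rewrite /reduce addrC subrK.
exists (reduce M g D f 0 l); split=> // K phi phip phif.
(* [u] is the column of the linear form sending [v] to the image of entry [l] of
   [reduce M g D v]. *)
pose u : 'cV[K]_n :=
  \col_a (phi D *+ (a == l) - \sum_i phi (M i 0 l) *+ (a == g i)).
have uE v : map_mx phi v *m u = (phi (reduce M g D v 0 l))%:M.
  apply/matrixP => a b; rewrite !ord1 !mxE mulr1n.
  rewrite rmorphB rmorphM summxE rmorph_sum.
  under eq_bigr do rewrite !mxE mulrBr mulr_sumr.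
  rewrite sumrB; congr (_ - _).
    rewrite (bigD1 l) //= big1 => [|c /negbTE->]; last by rewrite mulr0n mulr0.
    by rewrite eqxx mulr1n addr0 mulrC.
  rewrite exchange_big /=; apply: eq_bigr => i _.
  rewrite (bigD1 (g i)) //= big1 => [|c /negbTE->]; last by rewrite mulr0n mulr0.
  by rewrite eqxx mulr1n addr0 mxE rmorphM.
exists u; split=> [v Nv|].
  by rewrite uE phip ?raddf0 //; exact: Mmax.
by rewrite uE; apply: contraNneq phif => /matrixP/(_ 0 0); rewrite !mxE mulr1n => ->.
Qed.

End PrimeOfRealModule.

(** * The real saturation, presentations of the algebra, and the equality *)

Section Saturation.
Variables (K : realType) (A : comPzRingType) (iota : {rmorphism K -> A}) (n : nat).
Implicit Types J : set 'M[A]_n.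

(** At a real zero, evaluating [F + G^T] as a quadratic form at [u] gives 0. The sum of the squared
    lengths of the vectors [a j] therefore vanishes over [K], and so does each vector. *)
Lemma real_saturation_real J : real_left_ideal (real_saturation iota J).
Proof.
split; first split.
- by move=> q _; rewrite map_mx0 mul0mx.
- by move=> F G hF hG q hq; rewrite map_mxD mulmxDl hF // hG // addr0.
- by move=> F G hG q hq; rewrite map_mxM -mulmxA hG // mulmx0.
move=> k H [F hF [G hG E]] i q hq; set phi := q.1; set u := q.2.
pose a j : 'cV[K]_n := map_mx phi (H j) *m u.
have : \sum_(j < k) (a j)^T *m a j = 0.
  have /(congr1 (fun B => u^T *m (map_mx phi B *m u))) := E.
  rewrite map_mxD -map_trmx mulmxDl mulmxDr hF // mulmx0 add0r.
  rewrite mulmxA -trmx_mul hG // trmx0 mul0mx => E'; rewrite [RHS]E'.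
  rewrite map_mx_sum mulmx_suml mulmx_sumr; apply: eq_bigr => j _.
  by rewrite /a trmx_mul map_mxM -map_trmx !mulmxA.
move=> /matrixP/(_ 0 0); rewrite summxE mxE => /eqP.
have ge0 j : 0 <= ((a j)^T *m a j) 0 0.
  by rewrite mxE; apply: sumr_ge0 => l _; rewrite mxE -expr2 sqr_ge0.
rewrite psumr_eq0 // => /allP/(_ i); rewrite mem_index_enum => /(_ isT).
rewrite /= mxE psumr_eq0; last by move=> l _; rewrite mxE -expr2 sqr_ge0.
move=> /allP h; apply/matrixP => l b; rewrite ord1 [RHS]mxE.
have := h l; rewrite mem_index_enum => /(_ isT) /=.
by rewrite mxE -expr2 sqrf_eq0 => /eqP.
Qed.

Lemma sub_real_saturation J : J `<=` real_saturation iota J.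
Proof. by move=> F JF q [_ hq]; exact: hq. Qed.

Lemma finitely_generated_presentation :
  (1 : A) != 0 -> finitely_generated iota ->
  exists m (pi : {rmorphism iter_poly K m -> A}),
    (forall c, pi (iter_const K m c) = iota c) /\ forall a, exists x, pi x = a.
Proof.
move=> A10 [s hs].
pose A' : comNzRingType := HB.pack A (GRing.PzSemiRing_isNonZero.Build A A10).
pose m := size s.
pose pi : {rmorphism iter_poly K m -> A'} :=
  iter_eval (iota : {rmorphism K -> A'}) (nth 0 s) m.
have pic c : pi (iter_const K m c) = iota c by rewrite /pi iter_eval_const.
exists m, (pi : {rmorphism iter_poly K m -> A}); split=> // a.
have : smallest (subalgebra iota) [set` s] a by rewrite hs.
move=> /(_ [set b | exists x, pi x = b]); apply; split=> [|x xs].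
  split.
  - by move=> c; exists (iter_const K m c).
  - by move=> _ _ [x <-] [y <-]; exists (x + y); exact: rmorphD.
  - by move=> _ _ [x <-] [y <-]; exists (x * y); exact: rmorphM.
rewrite -(nth_index 0 xs) /pi; apply: iter_eval_var.
by rewrite index_mem.
Qed.

End Saturation.

Theorem theorem3 (K : realType) (A : comPzRingType)
    (iota : {rmorphism K -> A}) (hA : finitely_generated iota)
    (n : nat) (hn : (0 < n)%N) (J : set 'M[A]_n) (hJ : left_ideal J) :
  real_saturation iota J = real_radical J.
Proof.
apply/seteqP; split; last first.
  apply: real_radical_min; first exact: real_saturation_real.
  exact: sub_real_saturation.
have [[lI rI] JI] := real_radical_real J; set I := real_radical J in lI rI JI *.
move=> F satF.
have [A10|A10] := eqVneq (1 : A) 0.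
  have -> : F = 0 by apply/matrixP => a b; rewrite mxE -[LHS]mul1r A10 mul0r.
  by case: lI.
have [m [pi [piK /choice[sg sgK]]]] := finitely_generated_presentation A10 hA.
pose Q := iter_poly K m.
pose I' : set 'M[Q]_n := [set G | I (map_mx pi G)].
have [I0 ID IM] := lI.
have lI' : left_ideal I'.
  split; rewrite /I' /=.
  - by rewrite map_mx0.
  - by move=> G H hG hH; rewrite map_mxD; exact: ID.
  - by move=> G H hH; rewrite map_mxM; exact: IM.
have rI' : real_ideal I'.
  move=> k H [G hG [G' hG' E]]; apply: rI; exists (map_mx pi G) => //.
  exists (map_mx pi G') => //; rewrite map_trmx -map_mxD E map_mx_sum.
  by apply: eq_bigr => i _; rewrite map_mxM -map_trmx.
pose F' := map_mx sg F.
have sgM (G : 'M[A]_n) : map_mx pi (map_mx sg G) = G.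
  by apply/matrixP => a b; rewrite !mxE sgK.
apply: contrapT => nF.
have [i nFi] : exists i, ~ row_module I' (row i F').
  apply: contrapT => h; apply: nF; rewrite -(sgM F).
  apply/(row_moduleP lI') => i; apply: contrapT => hi; apply: h; by exists i.
have nQ : noetherian Q by exact: iter_poly_noetherian (@field_noetherian K).
have [a pa] := exists_prime_transporter lI' nQ nFi.
have rp := transporter_real lI' rI' hn (f := a *: row i F').
have [delta [nd sep]] := separating_functional lI' rI' hn pa.
have [phi' [phiK phip phid]] := real_nullstellensatz pa rp nd.
have [u [uN uf]] := sep _ _ phip phid.
(* An element of the kernel of [pi] multiplies every vector into [N], so it lies in [p]. Hence
   [phi'] factors through [A], and [ph] is the factor written with the section [sg]. *)
have pker x : pi x = 0 -> phi' x = 0.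
  move=> pix; apply: phip => w; rewrite /I' /= -scalemxAr.
  have -> : map_mx pi (x *: (w *m (a *: row i F'))) = 0.
    by apply/matrixP => b c; rewrite !mxE rmorphM pix mul0r.
  exact: I0.
have phi_sg x : phi' (sg (pi x)) = phi' x.
  by apply/eqP; rewrite -subr_eq0 -rmorphB; apply/eqP/pker; rewrite rmorphB sgK subrr.
pose ph b := phi' (sg b).
have phB : zmod_morphism ph.
  by move=> x y; rewrite /ph -[in LHS](sgK x) -[in LHS](sgK y) -rmorphB phi_sg rmorphB.
have phM : monoid_morphism ph.
  split; first by rewrite /ph -(rmorph1 pi) phi_sg rmorph1.
  by move=> x y; rewrite /ph -[in LHS](sgK x) -[in LHS](sgK y) -rmorphM phi_sg rmorphM.
pose phi : {rmorphism A -> K} := HB.pack ph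
  (GRing.isZmodMorphism.Build _ _ ph phB) (GRing.isMonoidMorphism.Build _ _ ph phM).
have phE (G : 'M[A]_n) : map_mx phi G = map_mx phi' (map_mx sg G).
  by apply/matrixP => b c; rewrite !mxE.
have zero : real_zeros iota J (phi, u).
  split; first split=> //.
    by move=> c; rewrite -piK /= /ph phi_sg phiK.
  move=> G JG; rewrite /= phE; apply/row_matrixP => b.
  rewrite row_mul row0 -map_row; apply: uN.
  by apply: (row_moduleP lI' _).1; rewrite /I' /= sgM; exact: JI.
have := satF _ zero; rewrite /= phE -/F' => E.
(* The value in [uf] is [phi' a] times row [i] of the image of [F] applied to [u], and this vanishes
   because [F] is in the saturation. *)
move/negP: uf; apply; apply/eqP.
have -> : map_mx phi' (a *: row i F') = phi' a *: map_mx phi' (row i F').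
  by apply/matrixP => b c; rewrite !mxE rmorphM.
by rewrite -scalemxAl map_row -row_mul E row0 scaler0.
Qed.
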